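(* Let $\varphi,\psi$ be functions of $x$, and define sequences $(a_n)_{n\ge0}$, $(b_n)_{n\ge 0}$ of functions of $x$ by $a_0=\varphi$, $b_0=\psi$ and, for $n\ge1$, $$a_n=a_{n-1}'+\psi\sum_{\substack{i+j=n-2\\ i,j\ge0}}a_ia_j,\qquad b_n=b_{n-1}'+\varphi\sum_{\substack{i+j=n-2\\ i,j\ge0}}b_ib_j .$$ Then the formal series $F_\infty(x,t)=\sum_{n=0}^\infty a_n(x)t^{-n}$ and $G_\infty(x,t)=\sum_{n=0}^\infty b_n(x)t^{-n}$ formally satisfy, respectively, the Riccati equations $$t\frac{\partial F}{\partial x}=-\psi F^2+t^2F-t^2\varphi,\qquad t\frac{\partial G}{\partial x}=-\varphi G^2+t^2G-t^2\psi .$$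
   Context: A prime denotes $d/dx$. The functions $\varphi,\psi$ are holomorphic on a domain $D\subset\mathbb{C}$. ''Formally'' means as identities of formal Laurent series in $t^{-1}$ with coefficients holomorphic functions of $x$ on $D$, with $\partial/\partial x$ acting coefficientwise. *)

(* Defs.v *)
From Stdlib Require Export Reals ZArith.
From Coquelicot Require Export Coquelicot.

Open Scope C_scope.

(* Functions on D are represented by total functions C -> C, of which only the
   values on D matter. *)

Definition connected (D : C -> Prop) : Prop :=
  forall U V : C -> Prop,
    open U -> open V ->
    (forall x, D x -> U x \/ V x) ->
    (exists x, D x /\ U x) ->
    (exists x, D x /\ V x) ->
    exists x, D x /\ U x /\ V x.

Definition domain (D : C -> Prop) : Prop :=
  open D /\ (exists x, D x) /\ connected D.

(* Coquelicot's derivative over C_AbsRing, i.e. complex differentiability;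
   C_derive f x is its value. *)
Definition holomorphic_on (D : C -> Prop) (f : C -> C) : Prop :=
  forall x, D x -> @ex_derive C_AbsRing C_NormedModule f x.

Definition conv (u v : nat -> C -> C) (m : nat) (x : C) : C :=
  sum_n (fun i => u i x * v (m - i)%nat x) m.

(* The sum of u_i v_j over i + j = n - 2, which is empty for n < 2. *)
Definition conv_minus2 (u v : nat -> C -> C) (n : nat) (x : C) : C :=
  match n with
  | S (S m) => conv u v m x
  | _ => 0
  end.

(* A formal Laurent series in 1/t with functions of x as coefficients:
   Laurent d u stands for  sum_(n >= 0) u_n(x) t^(d - n).  The same series has
   several such representations (d is only an upper bound for the powers of t
   that occur), so series are compared through [coef]. *)
Record laurent : Type := Laurent { top : Z; digits : nat -> C -> C }.

Declare Scope laurent_scope.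
Delimit Scope laurent_scope with L.
Bind Scope laurent_scope with laurent.

(* The coefficient of t^k. *)
Definition coef (F : laurent) (k : Z) (x : C) : C :=
  if (k <=? top F)%Z then digits F (Z.to_nat (top F - k)) x else 0.

Definition laurent_holomorphic (D : C -> Prop) (F : laurent) : Prop :=
  forall k : Z, holomorphic_on D (coef F k).

Definition laurent_eq (D : C -> Prop) (F G : laurent) : Prop :=
  forall (k : Z) (x : C), D x -> coef F k x = coef G k x.

Definition ladd (F G : laurent) : laurent :=
  let d := Z.max (top F) (top G) in
  Laurent d (fun n x => coef F (d - Z.of_nat n) x + coef G (d - Z.of_nat n) x).

Definition lopp (F : laurent) : laurent :=
  Laurent (top F) (fun n x => - digits F n x).

Definition lsub (F G : laurent) : laurent := ladd F (lopp G).

Definition lmul (F G : laurent) : laurent :=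
  Laurent (top F + top G) (conv (digits F) (digits G)).

(* The functions of x, embedded as series constant in t. *)
Definition lfun (f : C -> C) : laurent :=
  Laurent 0 (fun n x => match n with O => f x | S _ => 0 end).

Definition tvar : laurent :=
  Laurent 1 (fun n _ => match n with O => 1 | S _ => 0 end).

Definition ldx (F : laurent) : laurent :=
  Laurent (top F) (fun n => C_derive (digits F n)).

(* sum_(n >= 0) u_n(x) t^(-n) *)
Definition lseries (u : nat -> C -> C) : laurent := Laurent 0 u.

Notation "F + G" := (ladd F G) : laurent_scope.
Notation "F - G" := (lsub F G) : laurent_scope.
Notation "F * G" := (lmul F G) : laurent_scope.
Notation "- F" := (lopp F) : laurent_scope.
Notation "F == G 'on' D" := (laurent_eq D F G)
  (at level 70, G at next level, no associativity) : type_scope.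

(* Main.v *)
Require Import Defs.
From Stdlib Require Import Lra Lia.

(** Comparing coefficients of t^k turns the Riccati equation into the recursion
    defining (a_n).  The analytic content is that every a_n is holomorphic, i.e.
    that the derivative of a function which is merely complex differentiable on
    an open set is again complex differentiable.

    For this, Goursat's theorem on rectangles (by quadrisection) extends to an
    integrand that is continuous, and differentiable except at one point z.
    Applied to the difference quotient of f at z it gives f z * c z = N z, where
    N z and c z are the integrals of f w / (w - z) and 1 / (w - z) over the
    boundary of a fixed square.  Both can be differentiated twice under the
    integral sign, and c does not vanish at the centre of the square, so the
    derivative of f = N / c is differentiable there. *)

(** * Complex differentiability and continuity in terms of the modulus *)

Lemma is_derive_C_epsdelta (f : C -> C) (z l : C) :
  @is_derive C_AbsRing C_NormedModule f z l <->
  forall eps : R, (0 < eps)%R -> exists delta : R, (0 < delta)%R /\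
    forall w : C, (Cmod (w - z) < delta)%R ->
      (Cmod (f w - f z - l * (w - z)) <= eps * Cmod (w - z))%R.
Proof.
split.
- intros [_ H] eps Heps.
  destruct (H z (fun P HP => HP) (mkposreal eps Heps)) as [d Hd].
  exists d; split; [apply cond_pos|].
  intros w Hw.
  rewrite (Cmult_comm l).
  exact (Hd w Hw).
- intros H; split; [apply is_linear_scal_l|].
  intros y Hy eps.
  apply (is_filter_lim_locally_unique (K := C_AbsRing) (V := AbsRing_NormedModule C_AbsRing)) in Hy; subst y.
  destruct (H eps (cond_pos eps)) as [d [Hd Hw]].
  exists (mkposreal d Hd); intros w Hb.
  specialize (Hw w Hb).
  rewrite (Cmult_comm l) in Hw.
  exact Hw.
Qed.

(** The default balls of C are those of the product structure on R x R; [locally_C] says that they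
    generate the same neighbourhoods as the modulus discs. *)
Lemma locally_C_Cmod (P : C -> Prop) (z : C) :
  locally z P <-> exists delta : R, (0 < delta)%R /\ forall w : C, (Cmod (w - z) < delta)%R -> P w.
Proof.
split.
- intros H. apply locally_C in H. destruct H as [d Hd].
  exists d; split; [apply cond_pos|exact Hd].
- intros [d [Hd Hw]]. apply locally_C. exists (mkposreal d Hd); exact Hw.
Qed.

Lemma continuous_C_epsdelta (f : C -> C) (z : C) :
  @continuous C_UniformSpace C_UniformSpace f z <->
  forall eps : R, (0 < eps)%R -> exists delta : R, (0 < delta)%R /\
    forall w : C, (Cmod (w - z) < delta)%R -> (Cmod (f w - f z) < eps)%R.
Proof.
split.
- intros H eps Heps.
  apply (locally_C_Cmod (fun w => (Cmod (f w - f z) < eps)%R)).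
  apply (H (fun v => (Cmod (v - f z) < eps)%R)).
  apply locally_C_Cmod; exists eps; auto.
- intros H P HP.
  apply locally_C_Cmod in HP; destruct HP as [e [He HP]].
  destruct (H e He) as [d [Hd Hw]].
  apply locally_C_Cmod; exists d; split; auto.
Qed.

Lemma ex_derive_C_continuous (f : C -> C) (z : C) :
  @ex_derive C_AbsRing C_NormedModule f z -> @continuous C_UniformSpace C_UniformSpace f z.
Proof.
intros H P HP. apply locally_C. apply (ex_derive_continuous f z H). exact HP.
Qed.

Open Scope R_scope.

(** * Quadrisection *)

(** The left ends increase and stay below every right end, so their limit lies in all the
    intervals. *)
Lemma nested_halves (u h : nat -> R) :
  (forall n, 0 <= u n) ->
  (forall n, h n = (/ 2) ^ n) ->
  (forall n, u n <= u (S n) /\ u (S n) + h (S n) <= u n + h n) ->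
  exists p, forall n, u n <= p <= u n + h n.
Proof.
intros H0 Hh Hu.
assert (Hpos : forall n, 0 < h n) by (intro n; rewrite Hh; apply pow_lt; lra).
assert (Hdec : forall n, u n + h n <= u O + h O).
{ induction n as [|n IH]; [lra|]. specialize (Hu n); lra. }
destruct (ex_finite_lim_seq_incr u (u O + h O)) as [p Hp].
- intro n; apply Hu.
- intro n; specialize (Hdec n); specialize (Hpos n); lra.
- exists p; intro n; split.
  + apply (is_lim_seq_incr_compare u p Hp); intro m; apply Hu.
  + assert (Hm : forall m, u (n + m)%nat + h (n + m)%nat <= u n + h n).
    { induction m as [|m IH].
      - rewrite Nat.add_0_r; lra.
      - rewrite Nat.add_succ_r; specialize (Hu (n + m)%nat); lra. }
    apply (is_lim_seq_le (fun m => u (m + n)%nat) (fun _ => u n + h n) p (u n + h n)).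
    * intro m; rewrite Nat.add_comm; specialize (Hm m); specialize (Hpos (n + m)%nat); lra.
    * apply (is_lim_seq_incr_n u n p); exact Hp.
    * apply is_lim_seq_const.
Qed.

(** A square is given by its lower left corner and its side. The last subsquare is the default: if
    [E] is subadditive and the other three carry less than a quarter each, it must carry at least a
    quarter. *)
Definition quarter (E : R -> R -> R -> R) (s : R * R * R) : R * R * R :=
  let '(x, y, h) := s in
  let k := h / 2 in
  if Rle_dec (E x y h / 4) (E x y k) then (x, y, k)
  else if Rle_dec (E x y h / 4) (E (x + k) y k) then (x + k, y, k)
  else if Rle_dec (E x y h / 4) (E x (y + k) k) then (x, y + k, k)
  else (x + k, y + k, k).

(** Repeated choice of a heavy quarter gives nested squares on which [E] is at least
    [E 0 0 1 * h ^ 2]. At their common point this contradicts the local bound if [E 0 0 1] is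
    positive. *)
Lemma quadrisection (E : R -> R -> R -> R) :
  (forall x y h, 0 <= x -> 0 <= y -> 0 < h -> x + h <= 1 -> y + h <= 1 ->
     E x y h <= E x y (h / 2) + E (x + h / 2) y (h / 2)
              + E x (y + h / 2) (h / 2) + E (x + h / 2) (y + h / 2) (h / 2)) ->
  (forall p q, 0 <= p <= 1 -> 0 <= q <= 1 -> forall eps, 0 < eps ->
     exists delta, 0 < delta /\ forall x y h, 0 < h < delta ->
       0 <= x -> 0 <= y -> x + h <= 1 -> y + h <= 1 ->
       x <= p <= x + h -> y <= q <= y + h -> E x y h <= eps * h ^ 2) ->
  E 0 0 1 <= 0.
Proof.
intros Hsub Hloc.
destruct (Rle_lt_dec (E 0 0 1) 0) as [|He]; [assumption|exfalso].
set (s := fun n => Nat.iter n (quarter E) (0, 0, 1)).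
set (X := fun n => fst (fst (s n))).
set (Y := fun n => snd (fst (s n))).
set (H := fun n => snd (s n)).
assert (Hs : forall n, s n = (X n, Y n, H n)).
{ intro n; unfold X, Y, H; destruct (s n) as [[? ?] ?]; reflexivity. }
assert (Hh : forall n, H n = (/ 2) ^ n).
{ induction n as [|n IH]; [reflexivity|].
  unfold H; simpl. rewrite Hs; unfold quarter; rewrite <- IH.
  repeat destruct Rle_dec; simpl; lra. }
assert (Hpos : forall n, 0 < H n) by (intro n; rewrite Hh; apply pow_lt; lra).
assert (Hstep : forall n, X n <= X (S n) /\ X (S n) + H (S n) <= X n + H n).
{ intro n. specialize (Hpos n). unfold X at 2 3, H at 1; simpl; rewrite Hs; unfold quarter.
  repeat destruct Rle_dec; simpl; lra. }
assert (Hstepy : forall n, Y n <= Y (S n) /\ Y (S n) + H (S n) <= Y n + H n).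
{ intro n. specialize (Hpos n). unfold Y at 2 3, H at 1; simpl; rewrite Hs; unfold quarter.
  repeat destruct Rle_dec; simpl; lra. }
assert (HX : forall n, 0 <= X n /\ X n + H n <= 1).
{ induction n as [|n IH]; [unfold X, H; simpl; lra|]. specialize (Hstep n); lra. }
assert (HY : forall n, 0 <= Y n /\ Y n + H n <= 1).
{ induction n as [|n IH]; [unfold Y, H; simpl; lra|]. specialize (Hstepy n); lra. }
assert (HE : forall n, E 0 0 1 * (H n) ^ 2 <= E (X n) (Y n) (H n)).
{ induction n as [|n IH]; [unfold X, Y, H; simpl; lra|].
  destruct (HX n), (HY n).
  assert (Hq := Hsub (X n) (Y n) (H n) ltac:(lra) ltac:(lra) (Hpos n) ltac:(lra) ltac:(lra)).
  assert (Hn : E (X n) (Y n) (H n) / 4 <= E (X (S n)) (Y (S n)) (H (S n))).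
  { unfold X at 2, Y at 2, H at 2; simpl; rewrite Hs; unfold quarter.
    repeat destruct Rle_dec; simpl; lra. }
  assert (E 0 0 1 * H (S n) ^ 2 = E 0 0 1 * H n ^ 2 / 4) by (rewrite !Hh; simpl; field).
  lra. }
destruct (nested_halves X H (fun n => proj1 (HX n)) Hh Hstep) as [p Hp].
destruct (nested_halves Y H (fun n => proj1 (HY n)) Hh Hstepy) as [q Hq].
assert (Hp1 : 0 <= p <= 1) by (specialize (Hp O); unfold X, H in Hp; simpl in Hp; lra).
assert (Hq1 : 0 <= q <= 1) by (specialize (Hq O); unfold Y, H in Hq; simpl in Hq; lra).
(* Half of [E 0 0 1] is a small enough constant, since [HE] gives the lower bound with the full
   constant. *)
destruct (Hloc p q Hp1 Hq1 (E 0 0 1 / 2) ltac:(lra)) as [d [Hd Hbound]].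
destruct (pow_lt_1_zero (/ 2) ltac:(rewrite Rabs_pos_eq; lra) d Hd) as [N HN].
specialize (HN N (le_n N)); rewrite <- Hh, Rabs_pos_eq in HN by (specialize (Hpos N); lra).
specialize (Hpos N); destruct (HX N), (HY N).
specialize (Hbound (X N) (Y N) (H N) ltac:(lra) ltac:(lra) ltac:(lra) ltac:(lra) ltac:(lra)
  (Hp N) (Hq N)).
specialize (HE N).
assert (0 < E 0 0 1 * H N ^ 2) by (apply Rmult_lt_0_compat, pow_lt; assumption).
lra.
Qed.

(** * Integrals of complex-valued functions of a real variable *)

(** The endpoints may come in either order, because [rint_punctured] uses rectangles that start at
    an inner point and extend in all four directions. *)
Definition between (a b t : R) : Prop := Rmin a b <= t <= Rmax a b.

(** Taken componentwise so that real and imaginary parts can be estimated as real integrals;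
    [Cint_unique] identifies it with the vector-valued integral. *)
Definition Cint (f : R -> C) (a b : R) : C :=
  (RInt (fun t => fst (f t)) a b, RInt (fun t => snd (f t)) a b).

Definition ex_Cint (f : R -> C) (a b : R) : Prop := @ex_RInt C_R_NormedModule f a b.

Lemma Cint_unique (f : R -> C) (a b : R) (l : C) :
  @is_RInt C_R_NormedModule f a b l -> Cint f a b = l.
Proof.
apply (RInt_fct_extend_pair (U := R_NormedModule) (V := R_NormedModule)
  (@RInt R_CompleteNormedModule) (@RInt R_CompleteNormedModule));
  intros; apply is_RInt_unique; assumption.
Qed.

Lemma Cint_correct (f : R -> C) (a b : R) :
  ex_Cint f a b -> @is_RInt C_R_NormedModule f a b (Cint f a b).
Proof. intros [l Hl]; rewrite (Cint_unique f a b l Hl); exact Hl. Qed.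

Lemma ex_Cint_continuous (f : R -> C) (a b : R) :
  (forall t, between a b t -> @continuous R_UniformSpace C_UniformSpace f t) -> ex_Cint f a b.
Proof.
intros H.
apply (ex_RInt_fct_extend_pair (U := R_NormedModule) (V := R_NormedModule));
  apply (ex_RInt_continuous (V := R_CompleteNormedModule)); intros t Ht.
- apply (continuous_comp f (fun c : C => fst c)); [apply H, Ht|apply continuous_fst].
- apply (continuous_comp f (fun c : C => snd c)); [apply H, Ht|apply continuous_snd].
Qed.

Lemma Cint_plus (f g : R -> C) (a b : R) :
  ex_Cint f a b -> ex_Cint g a b ->
  Cint (fun t => f t + g t)%C a b = (Cint f a b + Cint g a b)%C.
Proof.
intros Hf Hg; apply Cint_unique.
apply (is_RInt_plus (V := C_R_NormedModule)); apply Cint_correct; assumption.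
Qed.

(** The integral is linear over R, so a complex factor is split into the real factors that act on
    the two components. *)
Lemma is_Cint_scal (k : C) (f : R -> C) (a b : R) (l : C) :
  @is_RInt C_R_NormedModule f a b l ->
  @is_RInt C_R_NormedModule (fun t => k * f t)%C a b (k * l)%C.
Proof.
intros H.
assert (H1 : @is_RInt R_NormedModule (fun t => fst (f t)) a b (fst l))
  by exact (is_RInt_fct_extend_fst (U := R_NormedModule) (V := R_NormedModule) f a b l H).
assert (H2 : @is_RInt R_NormedModule (fun t => snd (f t)) a b (snd l))
  by exact (is_RInt_fct_extend_snd (U := R_NormedModule) (V := R_NormedModule) f a b l H).
apply (is_RInt_fct_extend_pair (U := R_NormedModule) (V := R_NormedModule)); simpl.
- apply (is_RInt_minus (V := R_NormedModule));
    apply (is_RInt_scal (V := R_NormedModule)); assumption.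
- apply (is_RInt_plus (V := R_NormedModule));
    apply (is_RInt_scal (V := R_NormedModule)); assumption.
Qed.

Lemma Cint_scal (k : C) (f : R -> C) (a b : R) :
  ex_Cint f a b -> Cint (fun t => k * f t)%C a b = (k * Cint f a b)%C.
Proof. intros H; apply Cint_unique, is_Cint_scal, Cint_correct, H. Qed.

Lemma Cint_ext (f g : R -> C) (a b : R) :
  (forall t, between a b t -> f t = g t) -> Cint f a b = Cint g a b.
Proof.
intros H; unfold Cint.
f_equal; apply RInt_ext; intros t Ht; rewrite H; auto; unfold between; lra.
Qed.

Lemma Cint_Chasles (f : R -> C) (a b c : R) :
  ex_Cint f a b -> ex_Cint f b c -> (Cint f a b + Cint f b c)%C = Cint f a c.
Proof.
intros H1 H2; symmetry; apply Cint_unique.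
apply (is_RInt_Chasles (V := C_R_NormedModule)) with b; apply Cint_correct; assumption.
Qed.

Lemma Cint_swap (f : R -> C) (a b : R) :
  ex_Cint f a b -> Cint f b a = (- Cint f a b)%C.
Proof.
intros H; apply Cint_unique.
apply (is_RInt_swap (V := C_R_NormedModule)), Cint_correct, H.
Qed.

Lemma Cint_le (f : R -> C) (a b M : R) :
  ex_Cint f a b -> (forall t, between a b t -> Cmod (f t) <= M) ->
  Cmod (Cint f a b) <= Rabs (b - a) * M.
Proof.
assert (Hnorm : forall z : C, Cmod z = @norm R_AbsRing C_R_NormedModule z).
{ intro z; unfold Cmod.
  change (sqrt (fst z ^ 2 + snd z ^ 2) = sqrt (Rabs (fst z) ^ 2 + Rabs (snd z) ^ 2)).
  rewrite !pow2_abs; reflexivity. }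
intros Hf H; rewrite Hnorm.
apply (norm_RInt_le_const_abs (V := C_R_NormedModule) f a b).
- intros t Ht; rewrite <- Hnorm; apply H, Ht.
- apply Cint_correct, Hf.
Qed.

(** * Integrals over the boundary of a rectangle *)

(* The contour integral of g over the boundary of [x1, x2] x [y1, y2]. The sides
   may be given in either order, which changes the sign. *)
Definition rint (g : C -> C) (x1 x2 y1 y2 : R) : C :=
  (Cint (fun x => g (x, y1)) x1 x2 - Cint (fun x => g (x, y2)) x1 x2
   + Ci * (Cint (fun y => g (x2, y)) y1 y2 - Cint (fun y => g (x1, y)) y1 y2))%C.

Definition on_rect (P : C -> Prop) (x1 x2 y1 y2 : R) : Prop :=
  forall x y, between x1 x2 x -> between y1 y2 y -> P (x, y).

Definition ccont (g : C -> C) (z : C) : Prop :=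
  @continuous C_UniformSpace C_UniformSpace g z.

Definition cdiff (g : C -> C) (z : C) : Prop :=
  @ex_derive C_AbsRing C_NormedModule g z.

Lemma between_l a b : between a b a.
Proof. split; [apply Rmin_l|apply Rmax_l]. Qed.

Lemma between_r a b : between a b b.
Proof. split; [apply Rmin_r|apply Rmax_r]. Qed.

Lemma between_trans a b c d t : between a b c -> between a b d -> between c d t -> between a b t.
Proof.
unfold between, Rmin, Rmax; repeat destruct Rle_dec; lra.
Qed.

#[local] Hint Resolve between_l between_r between_trans : rect.

Lemma on_rect_sub P x1 x2 y1 y2 u1 u2 v1 v2 :
  on_rect P x1 x2 y1 y2 ->
  between x1 x2 u1 -> between x1 x2 u2 -> between y1 y2 v1 -> between y1 y2 v2 ->
  on_rect P u1 u2 v1 v2.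
Proof. intros H ? ? ? ? x y ? ?; apply H; eauto with rect. Qed.

Lemma on_rect_impl (P Q : C -> Prop) x1 x2 y1 y2 :
  (forall z, P z -> Q z) -> on_rect P x1 x2 y1 y2 -> on_rect Q x1 x2 y1 y2.
Proof. intros HPQ H x y ? ?; apply HPQ, H; assumption. Qed.

Lemma continuous_hor (g : C -> C) x y :
  ccont g (x, y) -> @continuous R_UniformSpace C_UniformSpace (fun t => g (t, y)) x.
Proof.
intros H; apply (continuous_comp (V := C_UniformSpace) (fun t : R => (t, y)) g); [|exact H].
intros P [d Hd]; exists d; intros t Ht; apply Hd; split; [exact Ht|apply ball_center].
Qed.

Lemma continuous_ver (g : C -> C) x y :
  ccont g (x, y) -> @continuous R_UniformSpace C_UniformSpace (fun t => g (x, t)) y.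
Proof.
intros H; apply (continuous_comp (V := C_UniformSpace) (fun t : R => (x, t)) g); [|exact H].
intros P [d Hd]; exists d; intros t Ht; apply Hd; split; [apply ball_center|exact Ht].
Qed.

Lemma ex_hor g x1 x2 y1 y2 u1 u2 v :
  on_rect (ccont g) x1 x2 y1 y2 ->
  between x1 x2 u1 -> between x1 x2 u2 -> between y1 y2 v ->
  ex_Cint (fun x => g (x, v)) u1 u2.
Proof.
intros H ? ? ?; apply ex_Cint_continuous; intros t Ht.
apply (continuous_hor g), H; eauto with rect.
Qed.

Lemma ex_ver g x1 x2 y1 y2 u v1 v2 :
  on_rect (ccont g) x1 x2 y1 y2 ->
  between x1 x2 u -> between y1 y2 v1 -> between y1 y2 v2 ->
  ex_Cint (fun y => g (u, y)) v1 v2.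
Proof.
intros H ? ? ?; apply ex_Cint_continuous; intros t Ht.
apply (continuous_ver g), H; eauto with rect.
Qed.

#[local] Hint Resolve ex_hor ex_ver : rect.

Lemma rint_split_x g x1 x2 x3 y1 y2 :
  on_rect (ccont g) x1 x3 y1 y2 -> between x1 x3 x2 ->
  rint g x1 x3 y1 y2 = (rint g x1 x2 y1 y2 + rint g x2 x3 y1 y2)%C.
Proof.
intros H Hx; unfold rint.
rewrite <- (Cint_Chasles (fun x => g (x, y1)) x1 x2 x3),
  <- (Cint_Chasles (fun x => g (x, y2)) x1 x2 x3) by eauto with rect.
ring.
Qed.

Lemma rint_split_y g x1 x2 y1 y2 y3 :
  on_rect (ccont g) x1 x2 y1 y3 -> between y1 y3 y2 ->
  rint g x1 x2 y1 y3 = (rint g x1 x2 y1 y2 + rint g x1 x2 y2 y3)%C.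
Proof.
intros H Hy; unfold rint.
rewrite <- (Cint_Chasles (fun y => g (x1, y)) y1 y2 y3),
  <- (Cint_Chasles (fun y => g (x2, y)) y1 y2 y3) by eauto with rect.
ring.
Qed.

Lemma rint_swap_x g x1 x2 y1 y2 :
  on_rect (ccont g) x1 x2 y1 y2 -> rint g x2 x1 y1 y2 = (- rint g x1 x2 y1 y2)%C.
Proof.
intros H; unfold rint.
rewrite (Cint_swap (fun x => g (x, y1)) x1 x2),
  (Cint_swap (fun x => g (x, y2)) x1 x2) by eauto with rect.
ring.
Qed.

Lemma rint_swap_y g x1 x2 y1 y2 :
  on_rect (ccont g) x1 x2 y1 y2 -> rint g x1 x2 y2 y1 = (- rint g x1 x2 y1 y2)%C.
Proof.
intros H; unfold rint.
rewrite (Cint_swap (fun y => g (x1, y)) y1 y2),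
  (Cint_swap (fun y => g (x2, y)) y1 y2) by eauto with rect.
ring.
Qed.

(** The Cauchy kernel has its pole inside the rectangle, so facts about it can only be assumed on
    the four sides. *)
Definition on_bdry (P : C -> Prop) (x1 x2 y1 y2 : R) : Prop :=
  (forall x, between x1 x2 x -> P (x, y1) /\ P (x, y2)) /\
  (forall y, between y1 y2 y -> P (x1, y) /\ P (x2, y)).

Lemma on_rect_bdry P x1 x2 y1 y2 : on_rect P x1 x2 y1 y2 -> on_bdry P x1 x2 y1 y2.
Proof. intros H; split; split; apply H; auto with rect. Qed.

Lemma on_bdry_impl (P Q : C -> Prop) x1 x2 y1 y2 :
  (forall z, P z -> Q z) -> on_bdry P x1 x2 y1 y2 -> on_bdry Q x1 x2 y1 y2.
Proof. intros HPQ [H1 H2]; split; intros t Ht; split; apply HPQ; (apply H1 || apply H2); exact Ht. Qed.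

Lemma on_bdry_and (P Q : C -> Prop) x1 x2 y1 y2 :
  on_bdry P x1 x2 y1 y2 -> on_bdry Q x1 x2 y1 y2 -> on_bdry (fun w => P w /\ Q w) x1 x2 y1 y2.
Proof.
intros [H1 H2] [H3 H4]; split; intros t Ht.
- specialize (H1 t Ht); specialize (H3 t Ht); tauto.
- specialize (H2 t Ht); specialize (H4 t Ht); tauto.
Qed.

Lemma ex_bdry g x1 x2 y1 y2 :
  on_bdry (ccont g) x1 x2 y1 y2 ->
  (ex_Cint (fun x => g (x, y1)) x1 x2 /\ ex_Cint (fun x => g (x, y2)) x1 x2) /\
  (ex_Cint (fun y => g (x1, y)) y1 y2 /\ ex_Cint (fun y => g (x2, y)) y1 y2).
Proof.
intros [H1 H2]; split; split; apply ex_Cint_continuous; intros t Ht.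
- exact (continuous_hor g _ _ (proj1 (H1 t Ht))).
- exact (continuous_hor g _ _ (proj2 (H1 t Ht))).
- exact (continuous_ver g _ _ (proj1 (H2 t Ht))).
- exact (continuous_ver g _ _ (proj2 (H2 t Ht))).
Qed.

Lemma rint_ext f g x1 x2 y1 y2 :
  on_bdry (fun z => f z = g z) x1 x2 y1 y2 -> rint f x1 x2 y1 y2 = rint g x1 x2 y1 y2.
Proof.
intros [H1 H2]; unfold rint.
rewrite (Cint_ext (fun x => f (x, y1)) (fun x => g (x, y1))) by (intros; apply H1; assumption).
rewrite (Cint_ext (fun x => f (x, y2)) (fun x => g (x, y2))) by (intros; apply H1; assumption).
rewrite (Cint_ext (fun y => f (x1, y)) (fun y => g (x1, y))) by (intros; apply H2; assumption).
rewrite (Cint_ext (fun y => f (x2, y)) (fun y => g (x2, y))) by (intros; apply H2; assumption).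
reflexivity.
Qed.

Lemma rint_plus f g x1 x2 y1 y2 :
  on_bdry (ccont f) x1 x2 y1 y2 -> on_bdry (ccont g) x1 x2 y1 y2 ->
  rint (fun z => f z + g z)%C x1 x2 y1 y2 = (rint f x1 x2 y1 y2 + rint g x1 x2 y1 y2)%C.
Proof.
intros Hf Hg; apply ex_bdry in Hf; apply ex_bdry in Hg; unfold rint.
rewrite 4!Cint_plus by tauto.
ring.
Qed.

Lemma rint_scal k g x1 x2 y1 y2 :
  on_bdry (ccont g) x1 x2 y1 y2 ->
  rint (fun z => k * g z)%C x1 x2 y1 y2 = (k * rint g x1 x2 y1 y2)%C.
Proof.
intros Hg; apply ex_bdry in Hg; unfold rint.
rewrite 4!Cint_scal by tauto.
ring.
Qed.

Lemma rint_le g x1 x2 y1 y2 M :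
  on_bdry (ccont g) x1 x2 y1 y2 -> on_bdry (fun z => Cmod (g z) <= M) x1 x2 y1 y2 ->
  Cmod (rint g x1 x2 y1 y2) <= 2 * M * (Rabs (x2 - x1) + Rabs (y2 - y1)).
Proof.
intros Hg [HM1 HM2]; apply ex_bdry in Hg; unfold rint.
assert (H1 := Cint_le (fun x => g (x, y1)) x1 x2 M ltac:(tauto) ltac:(intros; apply HM1; assumption)).
assert (H2 := Cint_le (fun x => g (x, y2)) x1 x2 M ltac:(tauto) ltac:(intros; apply HM1; assumption)).
assert (H3 := Cint_le (fun y => g (x1, y)) y1 y2 M ltac:(tauto) ltac:(intros; apply HM2; assumption)).
assert (H4 := Cint_le (fun y => g (x2, y)) y1 y2 M ltac:(tauto) ltac:(intros; apply HM2; assumption)).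
unfold Cminus.
eapply Rle_trans; [apply Cmod_triangle|].
rewrite Cmod_mult, Cmod_Ci.
assert (H5 := Cmod_triangle (Cint (fun x => g (x, y1)) x1 x2) (- Cint (fun x => g (x, y2)) x1 x2)).
assert (H6 := Cmod_triangle (Cint (fun y => g (x2, y)) y1 y2) (- Cint (fun y => g (x1, y)) y1 y2)).
rewrite Cmod_opp in H5, H6.
lra.
Qed.

Lemma is_Cint_affine (al be : C) a b :
  @is_RInt C_R_NormedModule (fun t => al + be * RtoC t)%C a b
    (RtoC (b - a) * al + be * RtoC ((b ^ 2 - a ^ 2) / 2))%C.
Proof.
apply (is_RInt_plus (V := C_R_NormedModule)).
- replace (RtoC (b - a) * al)%C with (@scal R_AbsRing C_R_NormedModule (b - a) al).
  + apply (is_RInt_const (V := C_R_NormedModule)).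
  + apply injective_projections; simpl; unfold scal; simpl; unfold mult; simpl; ring.
- apply is_Cint_scal.
  apply (is_RInt_fct_extend_pair (U := R_NormedModule) (V := R_NormedModule)); simpl.
  + replace ((b * (b * 1) - a * (a * 1)) / 2) with (minus (b ^ 2 / 2) (a ^ 2 / 2))
      by (unfold minus, plus, opp; simpl; field).
    apply (is_RInt_derive (V := R_CompleteNormedModule) (fun t => t ^ 2 / 2)).
    * intros; auto_derive; [trivial|simpl; field].
    * intros; apply continuous_id.
  + assert (H := is_RInt_const (V := R_NormedModule) a b 0).
    replace (scal (b - a) (0 : R_NormedModule)) with (0 : R) in H
      by (unfold scal; simpl; unfold mult; simpl; ring).
    exact H.
Qed.

(** The four sides are integrated explicitly and cancel. This lets [Goursat] subtract a first-order
    approximation from the integrand. *)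
Lemma rint_affine (al be : C) x1 x2 y1 y2 :
  rint (fun z => al + be * z)%C x1 x2 y1 y2 = 0%C.
Proof.
(* On a horizontal line the point is [x + Ci * y], so the integrand is affine in [x] with constant
   term [al + be * Ci * y]. *)
assert (Hh : forall y a b, Cint (fun x => al + be * (x, y))%C a b =
  (RtoC (b - a) * (al + be * Ci * RtoC y) + be * RtoC ((b ^ 2 - a ^ 2) / 2))%C).
{ intros y a b; rewrite <- (Cint_unique _ _ _ _ (is_Cint_affine (al + be * Ci * RtoC y)%C be a b)).
  apply Cint_ext; intros; apply injective_projections; simpl; ring. }
assert (Hv : forall x a b, Cint (fun y => al + be * (x, y))%C a b =
  (RtoC (b - a) * (al + be * RtoC x) + be * Ci * RtoC ((b ^ 2 - a ^ 2) / 2))%C).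
{ intros y a b; rewrite <- (Cint_unique _ _ _ _ (is_Cint_affine (al + be * RtoC y)%C (be * Ci)%C a b)).
  apply Cint_ext; intros; apply injective_projections; simpl; ring. }
unfold rint; rewrite !Hh, !Hv.
apply injective_projections; simpl; field.
Qed.

(** * Elementary facts on differentiability and continuity *)

Lemma cdiff_cont g z : cdiff g z -> ccont g z.
Proof. apply ex_derive_C_continuous. Qed.

#[local] Hint Resolve cdiff_cont : rect.

Lemma cdiff_eps g z :
  cdiff g z <-> exists l, forall eps, 0 < eps -> exists delta, 0 < delta /\
    forall w, Cmod (w - z) < delta -> Cmod (g w - g z - l * (w - z)) <= eps * Cmod (w - z).
Proof.
split; intros [l Hl]; exists l; apply is_derive_C_epsdelta, Hl.
Qed.

(** The derivatives of the inverse and of parameter integrals come with explicit quadratic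
    remainders, to which this test applies. *)
Lemma quadratic_is_derive (g : C -> C) (z l : C) (M d : R) :
  0 < d -> (forall k, Cmod k < d -> Cmod (g (z + k) - g z - l * k)%C <= M * Cmod k ^ 2) ->
  @is_derive C_AbsRing C_NormedModule g z l.
Proof.
intros Hd H; apply is_derive_C_epsdelta; intros eps Heps.
(* [Rabs M + 1] is a positive bound for [M] whatever its sign, so it may be divided by. *)
assert (HM : 0 < Rabs M + 1) by (assert (H1 := Rabs_pos M); lra).
assert (HM' := Rle_abs M).
exists (Rmin d (eps / (Rabs M + 1))); split.
- apply Rmin_case; [lra|]; apply Rdiv_lt_0_compat; lra.
- intros w Hw.
  assert (H1 := Rmin_l d (eps / (Rabs M + 1))); assert (H2 := Rmin_r d (eps / (Rabs M + 1))).
  assert (H3 := H (w - z)%C ltac:(lra)).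
  replace (z + (w - z))%C with w in H3 by ring.
  eapply Rle_trans; [exact H3|].
  assert (H0 := Cmod_ge_0 (w - z)).
  assert (H4 : Cmod (w - z) < eps / (Rabs M + 1)) by lra.
  apply Rlt_div_r in H4; [|lra].
  nra.
Qed.

Lemma ccont_affine (al be : C) z : ccont (fun w => al + be * w)%C z.
Proof.
apply cdiff_cont; exists be; apply (quadratic_is_derive _ _ _ 0 1); [lra|].
intros k _; replace (_ - _)%C with (0 : C) by ring; rewrite Cmod_0; lra.
Qed.

Lemma ccont_plus f g z : ccont f z -> ccont g z -> ccont (fun w => f w + g w)%C z.
Proof. apply (continuous_plus (V := C_R_NormedModule)). Qed.

Lemma ccont_mult (g h : C -> C) w : ccont g w -> ccont h w -> ccont (fun v => g v * h v)%C w.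
Proof.
intros Hg Hh P HP; apply locally_C in HP.
apply (continuous_mult (K := C_AbsRing) g h w); [| |exact HP].
- intros Q HQ; apply Hg, locally_C, HQ.
- intros Q HQ; apply Hh, locally_C, HQ.
Qed.

Lemma ccont_const (k : C) z : ccont (fun _ => k) z.
Proof. apply continuous_const. Qed.

(** * Goursat's theorem on rectangles, with and without an exceptional point *)

Lemma between_param x a s h r :
  0 <= h -> between (x + s * a) (x + (s + h) * a) r -> exists u, s <= u <= s + h /\ r = x + u * a.
Proof.
intros Hh Hr.
destruct (Req_dec a 0) as [->|Ha].
(* The segment is a single point, so every parameter describes it. *)
- exists s; split; [lra|]; unfold between in Hr; rewrite !Rmult_0_r, Rmin_left, Rmax_left in Hr; lra.
- exists ((r - x) / a); split; [|field; exact Ha].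
  assert (Hu : r = x + (r - x) / a * a) by (field; exact Ha).
  set (u := (r - x) / a) in *.
  unfold between, Rmin, Rmax in Hr; repeat destruct Rle_dec; destruct (Rdichotomy a 0 Ha); nra.
Qed.

Lemma param_between x a s : 0 <= s <= 1 -> between x (x + a) (x + s * a).
Proof. intros; unfold between, Rmin, Rmax; repeat destruct Rle_dec; nra. Qed.

Lemma Cmod_le_Rabs (x y : R) : Cmod (x, y) <= Rabs x + Rabs y.
Proof.
unfold Cmod; simpl fst; simpl snd.
apply Rsqr_incr_0_var.
- rewrite Rsqr_sqrt by nra.
  assert (H1 := Rabs_pos x); assert (H2 := Rabs_pos y).
  rewrite <- (pow2_abs x), <- (pow2_abs y); unfold Rsqr; nra.
- assert (H1 := Rabs_pos x); assert (H2 := Rabs_pos y); lra.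
Qed.

(** The rectangle is the image of the unit square under an affine map, with [a] and [b] possibly
    zero or negative; [quadrisection] is applied to the modulus of the integral over the image of a
    subsquare. *)
Lemma Goursat g x1 x2 y1 y2 :
  on_rect (cdiff g) x1 x2 y1 y2 -> rint g x1 x2 y1 y2 = 0%C.
Proof.
intros Hg.
assert (Hc : on_rect (ccont g) x1 x2 y1 y2) by (eapply on_rect_impl; [apply cdiff_cont|exact Hg]).
set (a := x2 - x1); set (b := y2 - y1).
assert (Hbx : forall s, 0 <= s <= 1 -> between x1 x2 (x1 + s * a)).
{ intros; replace x2 with (x1 + a) by (unfold a; ring); apply param_between; assumption. }
assert (Hby : forall s, 0 <= s <= 1 -> between y1 y2 (y1 + s * b)).
{ intros; replace y2 with (y1 + b) by (unfold b; ring); apply param_between; assumption. }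
set (E := fun s t h => Cmod (rint g (x1 + s * a) (x1 + (s + h) * a) (y1 + t * b) (y1 + (t + h) * b))).
assert (HE : E 0 0 1 <= 0).
{ apply quadrisection.
  - intros s t h Hs Ht Hh Hsh Hth; unfold E.
    assert (Hsub : forall s1 s2 t1 t2, 0 <= s1 <= 1 -> 0 <= s2 <= 1 -> 0 <= t1 <= 1 -> 0 <= t2 <= 1 ->
      on_rect (ccont g) (x1 + s1 * a) (x1 + s2 * a) (y1 + t1 * b) (y1 + t2 * b)).
    { intros; eapply on_rect_sub; [exact Hc|auto ..]. }
    assert (Hmid : forall x c u, between (x + u * c) (x + (u + h) * c) (x + (u + h / 2) * c)).
    { intros; unfold between, Rmin, Rmax; repeat destruct Rle_dec; nra. }
    replace (s + h / 2 + h / 2) with (s + h) by field.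
    replace (t + h / 2 + h / 2) with (t + h) by field.
    rewrite (rint_split_x g _ (x1 + (s + h / 2) * a)) by (auto; apply Hsub; lra).
    rewrite 2!(rint_split_y g _ _ (y1 + t * b) (y1 + (t + h / 2) * b) (y1 + (t + h) * b)) by (auto; apply Hsub; lra).
    eapply Rle_trans; [apply Cmod_triangle|].
    eapply Rle_trans; [apply Rplus_le_compat; apply Cmod_triangle|].
    lra.
  - intros p q Hp Hq eps Heps.
    set (P := (x1 + p * a, y1 + q * b) : C).
    destruct (proj1 (cdiff_eps g P) (Hg _ _ (Hbx p Hp) (Hby q Hq))) as [l Hl].
    set (m := Rabs a + Rabs b).
    assert (Hm : 0 <= m) by (unfold m; assert (H1 := Rabs_pos a); assert (H2 := Rabs_pos b); lra).
    (* The remainder is at most this constant times [h * m], and [rint_le] contributes a further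
       [2 * (h * m)]; the product is at most [eps * h ^ 2]. Using [m + 1] avoids division by zero
       when the rectangle is a point. *)
    destruct (Hl (eps / (2 * (m + 1) ^ 2))) as [d [Hd Hb]].
    { apply Rdiv_lt_0_compat; [lra|nra]. }
    exists (d / (m + 1)); split; [apply Rdiv_lt_0_compat; lra|].
    intros s t h Hh Hs Ht Hsh Hth Hps Hqt; unfold E.
    assert (Hhd : h * (m + 1) < d) by (apply Rlt_div_r; lra).
    assert (Hsub : on_rect (ccont g) (x1 + s * a) (x1 + (s + h) * a) (y1 + t * b) (y1 + (t + h) * b)).
    { eapply on_rect_sub; [exact Hc| | | |]; (apply Hbx || apply Hby); lra. }
    (* Affine functions integrate to 0, so g may be replaced by its first-order
       remainder at P. *)
    set (al := (l * P - g P)%C).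
    assert (Hr : rint g (x1 + s * a) (x1 + (s + h) * a) (y1 + t * b) (y1 + (t + h) * b) =
      rint (fun w => g w + (al + - l * w))%C (x1 + s * a) (x1 + (s + h) * a) (y1 + t * b) (y1 + (t + h) * b)).
    { rewrite rint_plus, rint_affine; [ring|apply on_rect_bdry, Hsub|].
      apply on_rect_bdry; intros x y _ _; apply ccont_affine. }
    rewrite Hr.
    eapply Rle_trans.
    + apply rint_le with (M := eps / (2 * (m + 1) ^ 2) * (h * m)); apply on_rect_bdry.
      * intros x y Hx Hy; apply ccont_plus; [apply Hsub; assumption|apply ccont_affine].
      * intros x y Hx Hy.
        apply between_param in Hx; [|lra]; apply between_param in Hy; [|lra].
        destruct Hx as [u [Hu ->]]; destruct Hy as [v [Hv ->]].
        set (Q := (x1 + u * a, y1 + v * b) : C).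
        assert (Hdist : Cmod (Q - P)%C <= h * m).
        { replace (Q - P)%C with (((u - p) * a, (v - q) * b) : C)
            by (apply injective_projections; simpl; ring).
          eapply Rle_trans; [apply Cmod_le_Rabs|].
          rewrite !Rabs_mult.
          assert (Rabs (u - p) <= h) by (apply Rabs_le; lra).
          assert (Rabs (v - q) <= h) by (apply Rabs_le; lra).
          assert (H1 := Rabs_pos a); assert (H2 := Rabs_pos b); unfold m; nra. }
        replace (g Q + (al + - l * Q))%C with
          (g Q - g P - l * (Q - P))%C
          by (unfold al; ring).
        eapply Rle_trans; [apply Hb; lra|].
        apply Rmult_le_compat_l; [|exact Hdist].
        left; apply Rdiv_lt_0_compat; [lra|nra].
    + replace (Rabs (x1 + (s + h) * a - (x1 + s * a)) + Rabs (y1 + (t + h) * b - (y1 + t * b))) with (h * m).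
      * replace (2 * (eps / (2 * (m + 1) ^ 2) * (h * m)) * (h * m)) with
          (eps * h ^ 2 * (m ^ 2 / (m + 1) ^ 2)) by (field; lra).
        assert (m ^ 2 / (m + 1) ^ 2 <= 1) by (apply Rle_div_l; nra).
        assert (0 <= eps * h ^ 2) by (apply Rmult_le_pos; nra).
        nra.
      * replace (x1 + (s + h) * a - (x1 + s * a)) with (h * a) by ring.
        replace (y1 + (t + h) * b - (y1 + t * b)) with (h * b) by ring.
        rewrite !Rabs_mult, (Rabs_pos_eq h) by lra; unfold m; ring. }
unfold E in HE.
replace (x1 + 0 * a) with x1 in HE by ring; replace (x1 + (0 + 1) * a) with x2 in HE by (unfold a; ring).
replace (y1 + 0 * b) with y1 in HE by ring; replace (y1 + (0 + 1) * b) with y2 in HE by (unfold b; ring).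
apply Cmod_eq_0; assert (H0 := Cmod_ge_0 (rint g x1 x2 y1 y2)); lra.
Qed.

(** A copy of the rectangle scaled by [h] is cut off at the bad corner. The remaining two pieces
    avoid the corner, so [Goursat] applies to them; near the corner [g] is bounded, so the small
    piece contributes a multiple of its perimeter, which tends to 0 with [h]. *)
Lemma rint_corner g x1 x2 y1 y2 :
  x1 <> x2 -> y1 <> y2 -> on_rect (ccont g) x1 x2 y1 y2 ->
  on_rect (fun w => w <> (x1, y1) -> cdiff g w) x1 x2 y1 y2 ->
  rint g x1 x2 y1 y2 = 0%C.
Proof.
intros Hx Hy Hc Hd.
set (a := x2 - x1); set (b := y2 - y1).
set (m := Rabs a + Rabs b).
assert (Hm : 0 <= m) by (unfold m; assert (H1 := Rabs_pos a); assert (H2 := Rabs_pos b); lra).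
assert (HcP : ccont g (x1, y1)) by (apply Hc; auto with rect).
destruct (proj1 (continuous_C_epsdelta g (x1, y1)) HcP 1 Rlt_0_1) as [d [Hd0 Hnear]].
set (M := Cmod (g (x1, y1)) + 1).
assert (HM : 0 < M) by (unfold M; assert (H1 := Cmod_ge_0 (g (x1, y1))); lra).
assert (Hsmall : forall h, 0 < h < 1 -> h * m < d -> Cmod (rint g x1 x2 y1 y2) <= 2 * M * (h * m)).
{ intros h Hh Hhd.
  set (u := x1 + h * a); set (v := y1 + h * b).
  assert (Hu : between x1 x2 u).
  { unfold u; replace x2 with (x1 + a) by (unfold a; ring); apply param_between; lra. }
  assert (Hv : between y1 y2 v).
  { unfold v; replace y2 with (y1 + b) by (unfold b; ring); apply param_between; lra. }
  rewrite (rint_split_x g x1 u x2 y1 y2 Hc Hu).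
  rewrite (rint_split_y g x1 u y1 v y2) by
    (try (eapply on_rect_sub; [exact Hc| | | |]); auto with rect).
  rewrite (Goursat g u x2 y1 y2), (Goursat g x1 u v y2).
  - rewrite !Cplus_0_r.
    replace (h * m) with (Rabs (u - x1) + Rabs (v - y1)).
    2:{ unfold u, v, m; replace (x1 + h * a - x1) with (h * a) by ring.
        replace (y1 + h * b - y1) with (h * b) by ring.
        rewrite !Rabs_mult, (Rabs_pos_eq h) by lra; ring. }
    apply rint_le; apply on_rect_bdry.
    + eapply on_rect_sub; [exact Hc| | | |]; auto with rect.
    + intros x y Hbx Hby.
      assert (Hbx' : between (x1 + 0 * a) (x1 + (0 + h) * a) x)
        by (replace (x1 + 0 * a) with x1 by ring; rewrite Rplus_0_l; exact Hbx).
      assert (Hby' : between (y1 + 0 * b) (y1 + (0 + h) * b) y)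
        by (replace (y1 + 0 * b) with y1 by ring; rewrite Rplus_0_l; exact Hby).
      apply between_param in Hbx'; [|lra]; apply between_param in Hby'; [|lra].
      destruct Hbx' as [s [Hs ->]]; destruct Hby' as [t [Ht ->]].
      set (Q := (x1 + s * a, y1 + t * b) : C).
      assert (HQ : Cmod (Q - (x1, y1)) < d).
      { replace (Q - (x1, y1))%C with ((s * a, t * b) : C)
          by (apply injective_projections; simpl; ring).
        eapply Rle_lt_trans; [apply Cmod_le_Rabs|].
        rewrite !Rabs_mult, !(Rabs_pos_eq s), !(Rabs_pos_eq t) by lra.
        assert (H1 := Rabs_pos a); assert (H2 := Rabs_pos b); unfold m in Hhd; nra. }
      apply Hnear in HQ.
      replace (g Q) with (g Q - g (x1, y1) + g (x1, y1))%C by ring.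
      eapply Rle_trans; [apply Cmod_triangle|]; unfold M; lra.
  - intros x y Hbx Hby; apply Hd; eauto with rect.
    intros Heq; injection Heq as -> ->.
    unfold v, b, between, Rmin, Rmax in Hby; repeat destruct Rle_dec; destruct (Rdichotomy y1 y2 Hy); nra.
  - intros x y Hbx Hby; apply Hd; eauto with rect.
    intros Heq; injection Heq as -> ->.
    unfold u, a, between, Rmin, Rmax in Hbx; repeat destruct Rle_dec; destruct (Rdichotomy x1 x2 Hx); nra. }
apply Cmod_eq_0.
assert (H0 := Cmod_ge_0 (rint g x1 x2 y1 y2)).
destruct (Req_dec (Cmod (rint g x1 x2 y1 y2)) 0) as [|He]; [assumption|exfalso].
set (e := Cmod (rint g x1 x2 y1 y2)) in *.
(* The scale [k / (m + k + 1)] is below 1 and makes [h * m < k], so [Hsmall] yields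
   [e < 2 * M * k <= e]. *)
set (k := Rmin d (e / (2 * M))).
assert (Hk : 0 < k) by (unfold k; apply Rmin_case; [lra|apply Rdiv_lt_0_compat; lra]).
assert (Hk1 := Rmin_l d (e / (2 * M))); assert (Hk2 := Rmin_r d (e / (2 * M))); fold k in Hk1, Hk2.
assert (Hh : 0 < k / (m + k + 1) < 1).
{ split; [apply Rdiv_lt_0_compat; lra|]; apply Rlt_div_l; lra. }
assert (Hhm : k / (m + k + 1) * m < k).
{ replace (k / (m + k + 1) * m) with (k * m / (m + k + 1)) by (field; lra).
  apply Rlt_div_l; [lra|nra]. }
specialize (Hsmall _ Hh ltac:(lra)).
assert (2 * M * (k / (m + k + 1) * m) < 2 * M * k) by (apply Rmult_lt_compat_l; lra).
assert (2 * M * k <= 2 * M * (e / (2 * M))) by (apply Rmult_le_compat_l; lra).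
replace (2 * M * (e / (2 * M))) with e in * by (field; lra).
lra.
Qed.

(** Cutting through the exceptional point gives four rectangles that have it as a corner.
    [rint_corner] is stated for the corner that comes first, so sides are reversed where
    necessary. *)
Lemma rint_punctured g x1 x2 y1 y2 p q :
  x1 < p < x2 -> y1 < q < y2 -> on_rect (ccont g) x1 x2 y1 y2 ->
  on_rect (fun w => w <> (p, q) -> cdiff g w) x1 x2 y1 y2 ->
  rint g x1 x2 y1 y2 = 0%C.
Proof.
intros Hp Hq Hc Hd.
assert (Hbp : between x1 x2 p) by (unfold between; rewrite Rmin_left, Rmax_right; lra).
assert (Hbq : between y1 y2 q) by (unfold between; rewrite Rmin_left, Rmax_right; lra).
assert (Hzero : forall u v, u <> p -> v <> q -> between x1 x2 u -> between y1 y2 v -> rint g p u q v = 0%C).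
{ intros u v Hu Hv Hbu Hbv; apply rint_corner; auto.
  - eapply on_rect_sub; eauto.
  - eapply on_rect_sub; eauto. }
assert (Hsub : forall u1 u2 v1 v2, between x1 x2 u1 -> between x1 x2 u2 -> between y1 y2 v1 -> between y1 y2 v2 ->
  on_rect (ccont g) u1 u2 v1 v2) by (intros; eapply on_rect_sub; eauto).
rewrite (rint_split_x g x1 p x2), !(rint_split_y g _ _ y1 q y2) by (auto; apply Hsub; auto with rect).
rewrite (rint_swap_x g p x1 y1 q), (rint_swap_x g p x1 q y2) by (apply Hsub; auto with rect).
rewrite (rint_swap_y g p x1 q y1), (rint_swap_y g p x2 q y1) by (apply Hsub; auto with rect).
rewrite !Hzero by (auto with rect; lra).
ring.
Qed.

(** * Algebraic rules for complex derivatives *)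

Lemma is_derive_C_AbsRing (f : C -> C) (z l : C) :
  @is_derive C_AbsRing (AbsRing_NormedModule C_AbsRing) f z l <->
  @is_derive C_AbsRing C_NormedModule f z l.
Proof.
(* The two module structures on C share the little-o condition, so only linearity is proved anew. *)
split; intros [_ H]; (split; [apply is_linear_scal_l|exact H]).
Qed.

Lemma is_derive_Cmult (f g : C -> C) (z df dg : C) :
  @is_derive C_AbsRing C_NormedModule f z df -> @is_derive C_AbsRing C_NormedModule g z dg ->
  @is_derive C_AbsRing C_NormedModule (fun w => f w * g w)%C z (df * g z + f z * dg)%C.
Proof.
intros Hf Hg; apply is_derive_C_AbsRing in Hf; apply is_derive_C_AbsRing in Hg.
apply is_derive_C_AbsRing.
exact (is_derive_mult (K := C_AbsRing) f g z df dg Hf Hg Cmult_comm).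
Qed.

Lemma is_derive_Cinv (z : C) : z <> 0%C ->
  @is_derive C_AbsRing C_NormedModule Cinv z (- / (z * z))%C.
Proof.
intros Hz; assert (Hz' := proj1 (Cmod_gt_0 z) Hz).
(* The remainder is exactly [k * k / (z * z * (z + k))], and the chosen radius keeps [Cmod (z + k)]
   above [Cmod z / 2]. *)
apply (quadratic_is_derive _ _ _ (2 / Cmod z ^ 3) (Cmod z / 2)); [lra|].
intros k Hk.
assert (Hzk : Cmod z / 2 <= Cmod (z + k)).
{ assert (H := Cmod_triangle (z + k) (- k)); rewrite Cmod_opp in H.
  replace (z + k + - k)%C with z in H by ring; lra. }
assert (Hzk0 : (z + k)%C <> 0%C) by (apply Cmod_gt_0; lra).
replace (/ (z + k) - / z - - / (z * z) * k)%C with (k * k / (z * z * (z + k)))%C by (field; auto).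
rewrite Cmod_div, !Cmod_mult by (repeat apply Cmult_neq_0; assumption).
assert (0 <= Cmod k) by apply Cmod_ge_0.
apply Rle_div_l; [repeat apply Rmult_lt_0_compat; lra|].
replace (2 / Cmod z ^ 3 * Cmod k ^ 2 * (Cmod z * Cmod z * Cmod (z + k)))
  with (Cmod k ^ 2 * (Cmod (z + k) / (Cmod z / 2))) by (field; lra).
assert (1 <= Cmod (z + k) / (Cmod z / 2)) by (apply Rle_div_r; lra).
nra.
Qed.

Lemma is_derive_Cinv_comp (f : C -> C) (z df : C) : f z <> 0%C ->
  @is_derive C_AbsRing C_NormedModule f z df ->
  @is_derive C_AbsRing C_NormedModule (fun w => / f w)%C z (df * - / (f z * f z))%C.
Proof.
intros Hz Hf; apply is_derive_C_AbsRing in Hf; exact (is_derive_comp (K := C_AbsRing) (V := C_NormedModule) Cinv f z _ df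
  (is_derive_Cinv (f z) Hz) Hf).
Qed.

Lemma cdiff_mult (f g : C -> C) (z : C) : cdiff f z -> cdiff g z -> cdiff (fun w => f w * g w)%C z.
Proof. intros [df Hf] [dg Hg]; eexists; apply is_derive_Cmult; eassumption. Qed.

Lemma cdiff_inv (f : C -> C) (z : C) : f z <> 0%C -> cdiff f z -> cdiff (fun w => / f w)%C z.
Proof. intros Hz [df Hf]; eexists; apply is_derive_Cinv_comp; eassumption. Qed.

Lemma cdiff_plus (f g : C -> C) (z : C) : cdiff f z -> cdiff g z -> cdiff (fun w => f w + g w)%C z.
Proof. apply (ex_derive_plus (K := C_AbsRing) (V := C_NormedModule)). Qed.

Lemma cdiff_minus (f g : C -> C) (z : C) : cdiff f z -> cdiff g z -> cdiff (fun w => f w - g w)%C z.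
Proof. apply (ex_derive_minus (K := C_AbsRing) (V := C_NormedModule)). Qed.

Lemma cdiff_const (k : C) z : cdiff (fun _ => k) z.
Proof. apply (ex_derive_const (K := C_AbsRing) (V := C_NormedModule)). Qed.

Lemma cdiff_id (z : C) : cdiff (fun w => w) z.
Proof. exists (RtoC 1); apply is_derive_C_AbsRing; exact (is_derive_id (K := C_AbsRing) z). Qed.

Lemma cdiff_ext_loc (f g : C -> C) (z : C) : locally z (fun w => f w = g w) -> cdiff f z -> cdiff g z.
Proof.
intros H; apply (ex_derive_ext_loc (K := C_AbsRing) (V := C_NormedModule)).
apply locally_C; exact H.
Qed.

Lemma locally_neq (w z : C) : w <> z -> locally w (fun v : C => v <> z).
Proof.
intros Hw; apply locally_C_Cmod; exists (Cmod (z - w)); split.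
- apply Cmod_gt_0; intros H; apply Hw; replace z with (z - w + w)%C by ring; rewrite H; ring.
- intros v Hv ->; lra.
Qed.

(** * Cauchy's formula *)

Lemma Cinv_sub_cdiff (z w : C) : w <> z -> cdiff (fun v => / (v - z))%C w.
Proof.
intros Hw; apply (cdiff_inv (fun v => v - z)%C).
- intros H; apply Hw; replace w with (w - z + z)%C by ring; rewrite H; ring.
- apply cdiff_minus; [apply cdiff_id|apply cdiff_const].
Qed.

Lemma ccont_scal (c : C) (f : C -> C) (z : C) : ccont f z -> ccont (fun w => c * f w)%C z.
Proof.
intros Hf; apply (continuous_comp (V := C_UniformSpace) f (fun v : C => (c * v)%C)); [exact Hf|].
apply cdiff_cont, cdiff_mult; [apply cdiff_const|apply cdiff_id].
Qed.

Lemma bdry_interior (P : C -> Prop) (x1 x2 y1 y2 p q : R) :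
  x1 < p < x2 -> y1 < q < y2 -> on_rect (fun w => w <> (p, q) -> P w) x1 x2 y1 y2 ->
  on_bdry P x1 x2 y1 y2.
Proof.
intros Hp Hq H; split; intros t Ht; split; apply H; auto with rect;
  intros Heq; injection Heq; lra.
Qed.

(** The difference quotient of [f] at the inner point, completed there by the derivative [l],
    satisfies [rint_punctured], so its integral vanishes. The integral of the kernel stands in place
    of the usual constant [2 * PI * Ci]. *)
Lemma Cauchy_formula f x1 x2 y1 y2 p q :
  x1 < p < x2 -> y1 < q < y2 -> on_rect (cdiff f) x1 x2 y1 y2 ->
  rint (fun w => f w * / (w - (p, q)))%C x1 x2 y1 y2 =
  (f (p, q) * rint (fun w => 1 * / (w - (p, q))) x1 x2 y1 y2)%C.
Proof.
intros Hp Hq Hf.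
set (z := (p, q) : C).
assert (Hz : cdiff f z).
{ apply Hf; unfold between; rewrite Rmin_left, Rmax_right; lra. }
destruct (proj1 (cdiff_eps f z) Hz) as [l Hl].
assert (Hdec : forall w : C, {w = z} + {w <> z}).
{ intros w; destruct (Req_dec_T (fst w) (fst z)) as [H1|H1];
    [destruct (Req_dec_T (snd w) (snd z)) as [H2|H2]|].
  - left; apply injective_projections; assumption.
  - right; intros ->; auto.
  - right; intros ->; auto. }
set (g := fun w => if Hdec w then l else ((f w - f z) * / (w - z))%C).
assert (Hgz : g z = l) by (unfold g; destruct (Hdec z); congruence).
assert (Hgw : forall w, w <> z -> g w = ((f w - f z) * / (w - z))%C)
  by (intros w Hw; unfold g; destruct (Hdec w); congruence).
assert (Hg : on_rect (fun w => w <> z -> cdiff g w) x1 x2 y1 y2).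
{ intros x y Hx Hy Hw.
  apply cdiff_ext_loc with (fun w => (f w - f z) * / (w - z))%C.
  - generalize (locally_neq _ _ Hw); apply filter_imp; intros v Hv; symmetry; apply Hgw, Hv.
  - apply cdiff_mult; [|apply Cinv_sub_cdiff, Hw].
    apply cdiff_minus; [apply Hf; assumption|apply cdiff_const]. }
assert (Hgc : on_rect (ccont g) x1 x2 y1 y2).
{ intros x y Hx Hy; destruct (Hdec (x, y)) as [->|Hw]; [|apply cdiff_cont, Hg; assumption].
  apply continuous_C_epsdelta; intros eps Heps.
  (* Halving [eps] turns the weak inequality of [Hl] into a strict one. *)
  destruct (Hl (eps / 2) ltac:(lra)) as [d [Hd Hdw]].
  exists d; split; [exact Hd|]; intros w Hw.
  rewrite Hgz; destruct (Hdec w) as [->|Hwz].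
  - rewrite Hgz; replace (l - l)%C with (RtoC 0) by ring; rewrite Cmod_0; exact Heps.
  - rewrite Hgw by exact Hwz.
    assert (Hne : (w - z)%C <> 0%C)
      by (intros H; apply Hwz; replace w with (w - z + z)%C by ring; rewrite H; ring).
    replace ((f w - f z) * / (w - z) - l)%C with ((f w - f z - l * (w - z)) / (w - z))%C
      by (field; exact Hne).
    assert (Hpos := proj1 (Cmod_gt_0 _) Hne).
    rewrite Cmod_div by exact Hne.
    apply Rlt_div_l; [exact Hpos|].
    specialize (Hdw w Hw); nra. }
assert (H0 := rint_punctured g x1 x2 y1 y2 p q Hp Hq Hgc Hg).
assert (Hk : on_bdry (ccont (fun w => 1 * / (w - z))%C) x1 x2 y1 y2).
{ apply (bdry_interior _ _ _ _ _ p q Hp Hq); intros x y _ _ Hw.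
  apply cdiff_cont, cdiff_mult; [apply cdiff_const|apply Cinv_sub_cdiff, Hw]. }
rewrite <- rint_scal by exact Hk.
(* The vanishing integral of [g] is added, so that the integrands agree pointwise on the
   boundary. *)
rewrite <- (Cplus_0_l (rint (fun w => f z * _)%C _ _ _ _)), <- H0.
rewrite <- rint_plus.
- apply rint_ext, (bdry_interior _ _ _ _ _ p q Hp Hq); intros x y _ _ Hw.
  rewrite Hgw by exact Hw; ring.
- apply on_rect_bdry, Hgc.
- apply (bdry_interior _ _ _ _ _ p q Hp Hq); intros x y _ _ Hw.
  apply cdiff_cont, cdiff_mult; [apply cdiff_const|].
  apply cdiff_mult; [apply cdiff_const|apply Cinv_sub_cdiff, Hw].
Qed.

(** * Differentiation under the integral sign *)

Lemma rint_param_derive (Phi : C -> C -> C) (Phi1 : C -> C) x1 x2 y1 y2 (z : C) (eta M : R) :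
  0 < eta ->
  (forall k, Cmod k < eta -> on_bdry (ccont (Phi (z + k)%C)) x1 x2 y1 y2) ->
  on_bdry (ccont Phi1) x1 x2 y1 y2 ->
  (forall k, Cmod k < eta ->
     on_bdry (fun w => Cmod (Phi (z + k) w - Phi z w - k * Phi1 w)%C <= M * Cmod k ^ 2) x1 x2 y1 y2) ->
  @is_derive C_AbsRing C_NormedModule (fun v => rint (Phi v) x1 x2 y1 y2) z (rint Phi1 x1 x2 y1 y2).
Proof.
intros Heta Hc Hc1 HM.
apply (quadratic_is_derive _ _ _ (2 * M * (Rabs (x2 - x1) + Rabs (y2 - y1))) eta Heta).
intros k Hk.
assert (Hc0 : on_bdry (ccont (Phi z)) x1 x2 y1 y2).
{ replace z with (z + 0)%C by ring; apply Hc; rewrite Cmod_0; exact Heta. }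
assert (HcN : forall (c : C) (F : C -> C), on_bdry (ccont F) x1 x2 y1 y2 ->
  on_bdry (ccont (fun w => c * F w)%C) x1 x2 y1 y2).
{ intros c F; apply on_bdry_impl; intros w Hw.
  exact (ccont_scal c F w Hw). }
assert (HcP : forall (F G : C -> C), on_bdry (ccont F) x1 x2 y1 y2 -> on_bdry (ccont G) x1 x2 y1 y2 ->
  on_bdry (ccont (fun w => F w + G w)%C) x1 x2 y1 y2).
{ intros F G HF HG; generalize (on_bdry_and _ _ _ _ _ _ HF HG); apply on_bdry_impl.
  intros w [H1 H2]; exact (ccont_plus F G w H1 H2). }
(* The remainder of the integral is the integral of the pointwise remainder, written with sums and
   multiples only to match [rint_plus] and [rint_scal]. *)
set (r := fun w => (Phi (z + k) w + (- (1) * Phi z w + - k * Phi1 w))%C).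
assert (Hr : (rint (Phi (z + k)%C) x1 x2 y1 y2 - rint (Phi z) x1 x2 y1 y2 - rint Phi1 x1 x2 y1 y2 * k)%C
  = rint r x1 x2 y1 y2).
{ unfold r; rewrite !rint_plus, !rint_scal; auto; ring. }
rewrite Hr.
replace (2 * M * _ * Cmod k ^ 2) with (2 * (M * Cmod k ^ 2) * (Rabs (x2 - x1) + Rabs (y2 - y1))) by ring.
apply rint_le; [unfold r; auto|].
generalize (HM k Hk); apply on_bdry_impl; intros w Hw; unfold r.
replace (_ + _)%C with (Phi (z + k) w - Phi z w - k * Phi1 w)%C by ring; exact Hw.
Qed.

(** Here [u] stands for [w - z], and moving [z] by [k] gives [u - k]. The remainder equals
    [k * k / (u * u * (u - k))], with [Cmod (u - k)] at least [d / 2]. *)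
Lemma kernel_remainder1 (u k : C) (d : R) :
  0 < d -> d <= Cmod u -> Cmod k < d / 2 ->
  Cmod (/ (u - k) - / u - k * (/ u * / u))%C <= 2 / d ^ 3 * Cmod k ^ 2.
Proof.
intros Hd Hu Hk.
assert (Huk : d / 2 <= Cmod (u - k)).
{ assert (H := Cmod_triangle (u - k) k); replace (u - k + k)%C with u in H by ring; lra. }
assert (Hu0 : u <> 0%C) by (apply Cmod_gt_0; lra).
assert (Huk0 : (u - k)%C <> 0%C) by (apply Cmod_gt_0; lra).
replace (/ (u - k) - / u - k * (/ u * / u))%C with (k * k / (u * u * (u - k)))%C by (field; auto).
rewrite Cmod_div, !Cmod_mult by (repeat apply Cmult_neq_0; assumption).
assert (0 <= Cmod k) by apply Cmod_ge_0.
apply Rle_div_l; [repeat apply Rmult_lt_0_compat; lra|].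
assert (H1 : d ^ 3 / 2 <= Cmod u * Cmod u * Cmod (u - k)).
{ replace (d ^ 3 / 2) with (d * d * (d / 2)) by (simpl; field).
  repeat apply Rmult_le_compat; nra. }
replace (2 / d ^ 3 * Cmod k ^ 2 * (Cmod u * Cmod u * Cmod (u - k)))
  with (Cmod k ^ 2 * ((Cmod u * Cmod u * Cmod (u - k)) / (d ^ 3 / 2))) by (field; lra).
assert (0 < d ^ 3) by (apply pow_lt; lra).
assert (1 <= (Cmod u * Cmod u * Cmod (u - k)) / (d ^ 3 / 2)) by (apply Rle_div_r; lra).
assert (0 <= Cmod k ^ 2) by apply pow2_ge_0.
nra.
Qed.

(** The numerator of the remainder contains [3 * u - 2 * k], which grows with [u]. It is bounded by
    [4 * Cmod u], and [Cmod (u - k)] is bounded below by [Cmod u / 2] rather than [d / 2], so that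
    the powers of [Cmod u] combine to [16 / Cmod u ^ 4]. *)
Lemma kernel_remainder2 (u k : C) (d : R) :
  0 < d -> d <= Cmod u -> Cmod k < d / 2 ->
  Cmod (/ (u - k) * / (u - k) - / u * / u - k * (2 * (/ u * / u * / u)))%C
    <= 16 / d ^ 4 * Cmod k ^ 2.
Proof.
intros Hd Hu Hk.
assert (Huk : Cmod u / 2 <= Cmod (u - k)).
{ assert (H := Cmod_triangle (u - k) k); replace (u - k + k)%C with u in H by ring; lra. }
assert (Hu0 : u <> 0%C) by (apply Cmod_gt_0; lra).
assert (Huk0 : (u - k)%C <> 0%C) by (apply Cmod_gt_0; lra).
replace (/ (u - k) * / (u - k) - / u * / u - k * (2 * (/ u * / u * / u)))%C
  with (k * k * (3 * u + - (2 * k)) / ((u - k) * (u - k) * (u * u * u)))%C by (field; auto).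
rewrite Cmod_div, !Cmod_mult by (repeat apply Cmult_neq_0; assumption).
assert (0 <= Cmod k) by apply Cmod_ge_0.
assert (H3 : Cmod (3 * u + - (2 * k)) <= 4 * Cmod u).
{ eapply Rle_trans; [apply Cmod_triangle|].
  rewrite Cmod_opp, !Cmod_mult, !Cmod_R, !Rabs_pos_eq by lra; lra. }
set (U := Cmod u) in *; set (V := Cmod (u - k)) in *; set (K := Cmod k) in *.
apply Rle_div_l; [repeat apply Rmult_lt_0_compat; lra|].
assert (HV : U * U / 4 <= V * V) by nra.
assert (HU3 : 0 < U * U * U) by (repeat apply Rmult_lt_0_compat; lra).
assert (Hd4 : 0 < d ^ 4) by (apply pow_lt; lra).
assert (HU4 : d ^ 4 <= U ^ 4) by (apply pow_incr; lra).
assert (H1 : 4 * U * (d ^ 4 / 16) <= V * V * (U * U * U)).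
{ apply Rle_trans with (U * U / 4 * (U * U * U)); [|apply Rmult_le_compat_r; lra].
  replace (U * U / 4 * (U * U * U)) with (4 * U * (U ^ 4 / 16)) by (simpl; field).
  apply Rmult_le_compat_l; lra. }
assert (H2 : 4 * U <= 16 / d ^ 4 * (V * V * (U * U * U))).
{ replace (4 * U) with (16 / d ^ 4 * (4 * U * (d ^ 4 / 16))) by (field; lra).
  apply Rmult_le_compat_l; [left; apply Rdiv_lt_0_compat; lra|exact H1]. }
replace (16 / d ^ 4 * K ^ 2 * (V * V * (U * U * U))) with (K * K * (16 / d ^ 4 * (V * V * (U * U * U)))) by ring.
apply Rmult_le_compat_l; [nra|lra].
Qed.

Section CauchyTransform.

Variables (f : C -> C) (x1 x2 y1 y2 : R) (M d : R) (z : C).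
Hypothesis Hd : 0 < d.
Hypothesis Hf : on_bdry (ccont f) x1 x2 y1 y2.
Hypothesis HM : on_bdry (fun w => Cmod (f w) <= M) x1 x2 y1 y2.
Hypothesis Hz : on_bdry (fun w => d <= Cmod (w - z)) x1 x2 y1 y2.

Lemma kernel_cont k w : Cmod k < d -> d <= Cmod (w - z) -> ccont (fun v => / (v - (z + k)))%C w.
Proof.
intros Hk Hw; apply cdiff_cont, Cinv_sub_cdiff; intros ->.
replace (z + k - z)%C with k in Hw by ring; lra.
Qed.

Lemma kernel_cont0 w : d <= Cmod (w - z) -> ccont (fun v => / (v - z))%C w.
Proof.
intros Hw; apply cdiff_cont, Cinv_sub_cdiff; intros ->.
replace (z - z)%C with (RtoC 0) in Hw by ring; rewrite Cmod_0 in Hw; lra.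
Qed.

(** Only continuity and a bound on the boundary are assumed of [f], so this serves for the given
    function as well as for the constant 1. *)
Lemma Cauchy_transform_derive1 :
  @is_derive C_AbsRing C_NormedModule
    (fun v => rint (fun w => f w * / (w - v))%C x1 x2 y1 y2) z
    (rint (fun w => f w * (/ (w - z) * / (w - z)))%C x1 x2 y1 y2).
Proof.
apply (rint_param_derive (fun v w => f w * / (w - v))%C _ _ _ _ _ _ (d / 2) (M * (2 / d ^ 3))).
- lra.
- intros k Hk; generalize (on_bdry_and _ _ _ _ _ _ Hf Hz); apply on_bdry_impl; intros w [Hfw Hw].
  apply ccont_mult; [exact Hfw|apply kernel_cont; lra].
- generalize (on_bdry_and _ _ _ _ _ _ Hf Hz); apply on_bdry_impl; intros w [Hfw Hw].
  apply ccont_mult; [exact Hfw|apply ccont_mult; exact (kernel_cont0 w Hw)].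
- intros k Hk; generalize (on_bdry_and _ _ _ _ _ _ HM Hz); apply on_bdry_impl; intros w [Hfw Hw].
  replace (f w * / (w - (z + k)) - f w * / (w - z) - k * (f w * (/ (w - z) * / (w - z))))%C
    with (f w * (/ (w - z - k) - / (w - z) - k * (/ (w - z) * / (w - z))))%C
    by (replace (w - (z + k))%C with (w - z - k)%C by ring; ring).
  rewrite Cmod_mult, Rmult_assoc.
  apply Rmult_le_compat; try apply Cmod_ge_0; [exact Hfw|].
  apply kernel_remainder1; assumption.
Qed.

Lemma Cauchy_transform_derive2 :
  @is_derive C_AbsRing C_NormedModule
    (fun v => rint (fun w => f w * (/ (w - v) * / (w - v)))%C x1 x2 y1 y2) z
    (rint (fun w => f w * (2 * (/ (w - z) * / (w - z) * / (w - z))))%C x1 x2 y1 y2).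
Proof.
apply (rint_param_derive (fun v w => f w * (/ (w - v) * / (w - v)))%C _ _ _ _ _ _ (d / 2)
  (M * (16 / d ^ 4))).
- lra.
- intros k Hk; generalize (on_bdry_and _ _ _ _ _ _ Hf Hz); apply on_bdry_impl; intros w [Hfw Hw].
  apply ccont_mult; [exact Hfw|apply ccont_mult; apply kernel_cont; lra].
- generalize (on_bdry_and _ _ _ _ _ _ Hf Hz); apply on_bdry_impl; intros w [Hfw Hw].
  apply ccont_mult; [exact Hfw|apply ccont_scal].
  apply ccont_mult; [apply ccont_mult|]; exact (kernel_cont0 w Hw).
- intros k Hk; generalize (on_bdry_and _ _ _ _ _ _ HM Hz); apply on_bdry_impl; intros w [Hfw Hw].
  replace (w - (z + k))%C with (w - z - k)%C by ring.
  set (u := (w - z)%C) in *.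
  replace (f w * (/ (u - k) * / (u - k)) - f w * (/ u * / u) - k * (f w * (2 * (/ u * / u * / u))))%C
    with (f w * (/ (u - k) * / (u - k) - / u * / u - k * (2 * (/ u * / u * / u))))%C by ring.
  rewrite Cmod_mult, Rmult_assoc.
  apply Rmult_le_compat; try apply Cmod_ge_0; [exact Hfw|].
  apply kernel_remainder2; assumption.
Qed.

End CauchyTransform.

(** * The winding integral, and holomorphy of the derivative *)

Lemma ex_RInt_fst (f : R -> C) a b : ex_Cint f a b -> ex_RInt (fun t => fst (f t)) a b.
Proof. exact (ex_RInt_fct_extend_fst (U := R_NormedModule) (V := R_NormedModule) f a b). Qed.

Lemma ex_RInt_snd (f : R -> C) a b : ex_Cint f a b -> ex_RInt (fun t => snd (f t)) a b.
Proof. exact (ex_RInt_fct_extend_snd (U := R_NormedModule) (V := R_NormedModule) f a b). Qed.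

Lemma RInt_ge_const (f : R -> R) a b m :
  a <= b -> ex_RInt f a b -> (forall t, a < t < b -> m <= f t) -> (b - a) * m <= RInt f a b.
Proof.
intros Hab Hf Hm.
replace ((b - a) * m) with (RInt (fun _ => m) a b) by (rewrite RInt_const; reflexivity).
apply RInt_le; auto; apply ex_RInt_const.
Qed.

Lemma RInt_le_const (f : R -> R) a b m :
  a <= b -> ex_RInt f a b -> (forall t, a < t < b -> f t <= m) -> RInt f a b <= (b - a) * m.
Proof.
intros Hab Hf Hm.
replace ((b - a) * m) with (RInt (fun _ => m) a b) by (rewrite RInt_const; reflexivity).
apply RInt_le; auto; apply ex_RInt_const.
Qed.

(* On each side the contribution to the imaginary part is the integral of a
   nonnegative function; only the bottom side is bounded away from 0. *)
Lemma winding_nonzero p q rho : 0 < rho ->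
  rint (fun w => 1 * / (w - (p, q)))%C (p - rho) (p + rho) (q - rho) (q + rho) <> 0%C.
Proof.
intros Hr.
set (g := fun w => (1 * / (w - (p, q)))%C).
assert (Hg : on_bdry (ccont g) (p - rho) (p + rho) (q - rho) (q + rho)).
{ apply (bdry_interior _ _ _ _ _ p q); [lra|lra|]; intros x y _ _ Hw.
  apply cdiff_cont, cdiff_mult; [apply cdiff_const|apply Cinv_sub_cdiff, Hw]. }
apply ex_bdry in Hg; destruct Hg as [[H1 H2] [H3 H4]].
apply ex_RInt_snd in H1; apply ex_RInt_snd in H2; apply ex_RInt_fst in H3; apply ex_RInt_fst in H4.
assert (Hre : forall x y, fst (g (x, y)) = (x - p) / ((x - p) ^ 2 + (y - q) ^ 2)).
{ intros; unfold g; rewrite Cmult_1_l; reflexivity. }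
assert (Him : forall x y, snd (g (x, y)) = - (y - q) / ((x - p) ^ 2 + (y - q) ^ 2)).
{ intros; unfold g; rewrite Cmult_1_l; reflexivity. }
(* On the bottom side the denominator is at most [2 * rho ^ 2], so the integrand is at least
   [1 / (2 * rho)] over a length of [2 * rho]. *)
assert (B1 : (p + rho - (p - rho)) * (1 / (2 * rho)) <= RInt (fun x => snd (g (x, q - rho))) (p - rho) (p + rho)).
{ apply RInt_ge_const; [lra|exact H1|]; intros t Ht; rewrite Him.
  replace (- (q - rho - q)) with rho by ring.
  apply Rle_div_l; [lra|].
  replace (rho / ((t - p) ^ 2 + (q - rho - q) ^ 2) * (2 * rho)) with (2 * rho ^ 2 / ((t - p) ^ 2 + rho ^ 2))
    by (field; nra).
  apply Rle_div_r; nra. }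
assert (B2 : RInt (fun x => snd (g (x, q + rho))) (p - rho) (p + rho) <= (p + rho - (p - rho)) * 0).
{ apply RInt_le_const; [lra|exact H2|]; intros t Ht; rewrite Him.
  apply Rle_div_l; nra. }
assert (B3 : RInt (fun y => fst (g (p - rho, y))) (q - rho) (q + rho) <= (q + rho - (q - rho)) * 0).
{ apply RInt_le_const; [lra|exact H3|]; intros t Ht; rewrite Hre.
  apply Rle_div_l; nra. }
assert (B4 : (q + rho - (q - rho)) * 0 <= RInt (fun y => fst (g (p + rho, y))) (q - rho) (q + rho)).
{ apply RInt_ge_const; [lra|exact H4|]; intros t Ht; rewrite Hre.
  apply Rle_div_r; nra. }
replace ((p + rho - (p - rho)) * (1 / (2 * rho))) with 1 in B1 by (field; lra).
intros H; apply (f_equal snd) in H.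
unfold rint, Cint, Cminus, Cmult, Copp, Cplus, Ci, RtoC in H; cbn [fst snd] in H.
lra.
Qed.

Lemma holomorphic_derive (D : C -> Prop) (f : C -> C) :
  open D -> holomorphic_on D f -> holomorphic_on D (C_derive f).
Proof.
intros HD Hf [p q] Hz; set (z := (p, q) : C) in *.
destruct (proj1 (locally_C_Cmod D z) (HD z Hz)) as [r0 [Hr0 HrD]].
assert (Hfc : ccont f z) by (apply cdiff_cont, Hf, Hz).
destruct (proj1 (continuous_C_epsdelta f z) Hfc 1 Rlt_0_1) as [r1 [Hr1 Hb]].
(* Points of the square are within [2 * rho] of [z]; so the square lies in [D], and [f] differs
   there from [f z] by less than 1, which yields the bound [M]. *)
set (rho := Rmin r0 r1 / 4).
assert (Hmin0 := Rmin_l r0 r1); assert (Hmin1 := Rmin_r r0 r1).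
assert (Hmin : 0 < Rmin r0 r1) by (apply Rmin_case; assumption).
assert (Hrho : 0 < rho) by (unfold rho; lra).
set (x1 := p - rho); set (x2 := p + rho); set (y1 := q - rho); set (y2 := q + rho).
assert (Hnear : on_rect (fun w => Cmod (w - z) < Rmin r0 r1) x1 x2 y1 y2).
{ intros x y Hx Hy.
  unfold between, x1, x2, y1, y2 in Hx, Hy; rewrite Rmin_left, Rmax_right in Hx, Hy by lra.
  replace ((x, y) - z)%C with ((x - p, y - q) : C) by (apply injective_projections; simpl; ring).
  eapply Rle_lt_trans; [apply Cmod_le_Rabs|].
  assert (Rabs (x - p) <= rho) by (apply Rabs_le; lra).
  assert (Rabs (y - q) <= rho) by (apply Rabs_le; lra).
  unfold rho in *; lra. }
assert (HfR : on_rect (cdiff f) x1 x2 y1 y2).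
{ intros x y Hx Hy; apply Hf, HrD; specialize (Hnear x y Hx Hy); simpl in Hnear; lra. }
assert (Hf1 : on_bdry (ccont f) x1 x2 y1 y2).
{ apply on_rect_bdry; intros x y Hx Hy; exact (cdiff_cont _ _ (HfR x y Hx Hy)). }
set (M := Cmod (f z) + 1).
assert (HfM : on_bdry (fun w => Cmod (f w) <= M) x1 x2 y1 y2).
{ apply on_rect_bdry; intros x y Hx Hy; specialize (Hnear x y Hx Hy); simpl in Hnear.
  specialize (Hb (x, y) ltac:(lra)).
  replace (f (x, y)) with (f (x, y) - f z + f z)%C by ring.
  eapply Rle_trans; [apply Cmod_triangle|]; unfold M; lra. }
assert (H1c : on_bdry (ccont (fun _ => RtoC 1)) x1 x2 y1 y2)
  by (apply on_rect_bdry; intros x y _ _; apply ccont_const).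
assert (H1M : on_bdry (fun w => Cmod 1 <= 1) x1 x2 y1 y2)
  by (apply on_rect_bdry; intros x y _ _; rewrite Cmod_1; lra).
(* The sides are at distance at least [rho] from the centre, so [rho / 2] can serve as [d] in the
   Cauchy transforms for all [v] near [z]. *)
assert (Hfar : forall v, Cmod (v - z) < rho / 2 -> on_bdry (fun w => rho / 2 <= Cmod (w - v)) x1 x2 y1 y2).
{ intros v Hv.
  assert (Hw : forall w, rho <= Cmod (w - z) -> rho / 2 <= Cmod (w - v)).
  { intros w Hw; assert (H := Cmod_triangle (w - v) (v - z)).
    replace (w - v + (v - z))%C with (w - z)%C in H by ring; lra. }
  split; intros t Ht; split; apply Hw;
    (eapply Rle_trans; [|apply Rmax_Cmod]); simpl; unfold x1, x2, y1, y2.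
  - eapply Rle_trans; [|apply Rmax_r]; rewrite Rabs_left; lra.
  - eapply Rle_trans; [|apply Rmax_r]; rewrite Rabs_pos_eq; lra.
  - eapply Rle_trans; [|apply Rmax_l]; rewrite Rabs_left; lra.
  - eapply Rle_trans; [|apply Rmax_l]; rewrite Rabs_pos_eq; lra. }
set (T := fun (g : C -> C) v => rint (fun w => g w * / (w - v))%C x1 x2 y1 y2).
set (T1 := fun (g : C -> C) v => rint (fun w => g w * (/ (w - v) * / (w - v)))%C x1 x2 y1 y2).
set (one := fun _ : C => RtoC 1).
assert (Hhalf : 0 < rho / 2) by lra.
assert (HT : forall g K v, on_bdry (ccont g) x1 x2 y1 y2 -> on_bdry (fun w => Cmod (g w) <= K) x1 x2 y1 y2 ->
  Cmod (v - z) < rho / 2 ->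
  @is_derive C_AbsRing C_NormedModule (T g) v (T1 g v) /\ cdiff (T1 g) v).
{ intros g K v Hgc HgK Hv; split.
  - exact (Cauchy_transform_derive1 g x1 x2 y1 y2 K (rho / 2) v Hhalf Hgc HgK (Hfar v Hv)).
  - eexists; exact (Cauchy_transform_derive2 g x1 x2 y1 y2 K (rho / 2) v Hhalf Hgc HgK (Hfar v Hv)). }
assert (Hzz : Cmod (z - z) < rho / 2) by (replace (z - z)%C with (RtoC 0) by ring; rewrite Cmod_0; lra).
assert (Hc0 : T one z <> 0%C) by exact (winding_nonzero p q rho Hrho).
assert (Hcc : ccont (T one) z) by (apply cdiff_cont; exists (T1 one z); apply (HT one 1); auto).
(* By continuity the denominator of the quotient stays nonzero on a whole disc around the centre. *)
destruct (proj1 (continuous_C_epsdelta (T one) z) Hcc (Cmod (T one z)) (proj1 (Cmod_gt_0 _) Hc0))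
  as [r2 [Hr2 Hcb]].
set (r := Rmin r2 (rho / 2)).
assert (Hr2' := Rmin_l r2 (rho / 2)); assert (Hrho' := Rmin_r r2 (rho / 2)); fold r in Hr2', Hrho'.
assert (Hr : 0 < r) by (apply Rmin_case; lra).
assert (Hcv : forall v, Cmod (v - z) < r -> T one v <> 0%C).
{ intros v Hv H0; specialize (Hcb v ltac:(lra)); rewrite H0 in Hcb.
  replace (0 - T one z)%C with (- T one z)%C in Hcb by ring; rewrite Cmod_opp in Hcb; lra. }
(* The square stays fixed while [v] moves, so that both integrals are smooth in [v]. *)
assert (Hquot : forall v, Cmod (v - z) < r -> f v = (T f v * / T one v)%C).
{ intros v Hv.
  assert (Hcomp : Rabs (fst v - p) < rho /\ Rabs (snd v - q) < rho).
  { assert (H := Rmax_Cmod (v - z)%C); simpl in H.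
    assert (H1 := Rmax_l (Rabs (fst v + - p)) (Rabs (snd v + - q))).
    assert (H2 := Rmax_r (Rabs (fst v + - p)) (Rabs (snd v + - q))).
    unfold Rminus; lra. }
  destruct Hcomp as [Hp Hq]; apply Rabs_def2 in Hp; apply Rabs_def2 in Hq.
  destruct v as [v1 v2]; simpl in Hp, Hq.
  assert (HC : T f (v1, v2) = (f (v1, v2) * T one (v1, v2))%C)
    by exact (Cauchy_formula f x1 x2 y1 y2 v1 v2 ltac:(unfold x1, x2; lra) ltac:(unfold y1, y2; lra) HfR).
  specialize (Hcv _ Hv); rewrite HC; field; exact Hcv. }
(* The quotient rule must hold on a disc, not only at [z], since [C_derive f] itself is to be
   differentiated at [z]. *)
assert (Hder : forall v, Cmod (v - z) < r ->
  (T1 f v * / T one v + T f v * (T1 one v * - / (T one v * T one v)))%C = C_derive f v).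
{ intros v Hv; symmetry; apply is_C_derive_unique.
  apply (is_derive_ext_loc (K := C_AbsRing) (V := C_NormedModule) (fun u => T f u * / T one u)%C).
  - apply locally_C, locally_C_Cmod; exists (r - Cmod (v - z)); split; [lra|].
    intros u Hu; symmetry; apply Hquot.
    assert (H := Cmod_triangle (u - v) (v - z)).
    replace (u - v + (v - z))%C with (u - z)%C in H by ring; lra.
  - apply (is_derive_Cmult (T f) (fun u => / T one u)%C); [apply (HT f M); auto; lra|].
    apply (is_derive_Cinv_comp (T one)); [apply Hcv, Hv|apply (HT one 1); auto; lra]. }
apply (cdiff_ext_loc (fun v => T1 f v * / T one v + T f v * (T1 one v * - / (T one v * T one v)))%C).
- apply locally_C_Cmod; exists r; split; [exact Hr|exact Hder].
- assert (Dc : cdiff (T one) z) by (exists (T1 one z); apply (HT one 1); auto).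
  assert (Dc1 : cdiff (T1 one) z) by (apply (HT one 1); auto).
  assert (Dn : cdiff (T f) z) by (exists (T1 f z); apply (HT f M); auto).
  assert (Dn1 : cdiff (T1 f) z) by (apply (HT f M); auto).
  apply (cdiff_plus (fun v => T1 f v * / T one v)%C (fun v => T f v * (T1 one v * - / (T one v * T one v)))%C).
  + exact (cdiff_mult (T1 f) _ z Dn1 (cdiff_inv (T one) z Hc0 Dc)).
  + apply (cdiff_mult (T f) (fun v => T1 one v * - / (T one v * T one v))%C z Dn).
    apply (cdiff_mult (T1 one) (fun v => - / (T one v * T one v))%C z Dc1).
    apply (ex_derive_opp (K := C_AbsRing) (V := C_NormedModule) (fun v => / (T one v * T one v))%C).
    apply (cdiff_inv (fun v => T one v * T one v)%C).
    * apply Cmult_neq_0; assumption.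
    * exact (cdiff_mult (T one) (T one) z Dc Dc).
Qed.

Open Scope C_scope.

(** * Formal series *)

Lemma sum_n_first (w : nat -> C) (m : nat) :
  (forall i, w (S i) = 0) -> sum_n w m = w O.
Proof.
intros Hw; induction m as [|m IH]; [apply sum_O|].
rewrite sum_Sn, IH, Hw; apply Cplus_0_r.
Qed.

Lemma conv_const_l (u v : nat -> C -> C) (m : nat) (x : C) :
  (forall n, u (S n) x = 0) -> conv u v m x = u O x * v m x.
Proof.
intros Hu; unfold conv; rewrite sum_n_first.
- rewrite Nat.sub_0_r; reflexivity.
- intro i; rewrite Hu; apply Cmult_0_l.
Qed.

Lemma coef_ladd F G k x : coef (ladd F G) k x = coef F k x + coef G k x.
Proof.
unfold coef at 1; simpl.
destruct (Z.leb_spec k (Z.max (top F) (top G))) as [H|H].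
- replace (Z.max (top F) (top G) - Z.of_nat (Z.to_nat (Z.max (top F) (top G) - k)))%Z with k by lia.
  reflexivity.
- unfold coef.
  destruct (Z.leb_spec k (top F)); [lia|]; destruct (Z.leb_spec k (top G)); [lia|].
  ring.
Qed.

Lemma coef_lopp F k x : coef (lopp F) k x = - coef F k x.
Proof. unfold coef; simpl; destruct (k <=? top F)%Z; [reflexivity|ring]. Qed.

Lemma coef_lsub F G k x : coef (lsub F G) k x = coef F k x - coef G k x.
Proof. unfold lsub; rewrite coef_ladd, coef_lopp; reflexivity. Qed.

(** At [x] the factor [F] is a single monomial of degree [top F], so it scales and shifts
    coefficients. This covers [tvar], its square and [lfun f]. *)
Lemma coef_monomial_mul F G k x :
  (forall n, digits F (S n) x = 0) ->
  coef (lmul F G) k x = digits F O x * coef G (k - top F) x.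
Proof.
intros HF; unfold coef; simpl.
destruct (Z.leb_spec k (top F + top G)); destruct (Z.leb_spec (k - top F) (top G)); try lia.
- rewrite conv_const_l by exact HF.
  replace (top F + top G - k)%Z with (top G - (k - top F))%Z by ring; reflexivity.
- ring.
Qed.

Lemma coef_tvar_mul F k x : coef (lmul tvar F) k x = coef F (k - 1) x.
Proof. rewrite coef_monomial_mul by reflexivity; apply Cmult_1_l. Qed.

Lemma coef_tvar2_mul F k x : coef (lmul (lmul tvar tvar) F) k x = coef F (k - 2) x.
Proof.
rewrite coef_monomial_mul; simpl.
- rewrite conv_const_l by reflexivity; simpl; ring.
- intros n; rewrite conv_const_l by reflexivity; simpl; ring.
Qed.

Lemma coef_lfun_mul f F k x : coef (lmul (lfun f) F) k x = f x * coef F k x.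
Proof. rewrite coef_monomial_mul by reflexivity; simpl; rewrite Z.sub_0_r; reflexivity. Qed.

(** * From the recursion to the Riccati equation *)

Section Riccati.

Variables (D : C -> Prop) (phi psi : C -> C) (a : nat -> C -> C).
Hypothesis HD : open D.
Hypothesis Hphi : holomorphic_on D phi.
Hypothesis Hpsi : holomorphic_on D psi.
Hypothesis Ha0 : forall x, D x -> a O x = phi x.
Hypothesis Ha : forall (n : nat) (x : C), (1 <= n)%nat -> D x ->
  a n x = C_derive (a (n - 1)%nat) x + psi x * conv_minus2 a a n x.

(** As [D] is open, equality on [D] is equality near each of its points. *)
Lemma holomorphic_on_ext (f g : C -> C) :
  (forall x, D x -> g x = f x) -> holomorphic_on D f -> holomorphic_on D g.
Proof.
intros H Hf x Hx; apply (cdiff_ext_loc f); [|exact (Hf x Hx)].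
generalize (HD x Hx); apply filter_imp; intros y Hy; symmetry; apply H, Hy.
Qed.

Lemma conv_holomorphic (u v : nat -> C -> C) (m : nat) :
  (forall n, (n <= m)%nat -> holomorphic_on D (u n)) ->
  (forall n, (n <= m)%nat -> holomorphic_on D (v n)) -> holomorphic_on D (conv u v m).
Proof.
intros Hu Hv x Hx.
apply (ex_derive_sum_n (K := C_AbsRing) (V := C_NormedModule)
  (fun i y => u i y * v (m - i)%nat y)).
intros k Hk; apply cdiff_mult; [apply Hu|apply Hv]; auto; lia.
Qed.

(** The convolution involves earlier terms of all orders, hence strong induction; the derivative
    term is handled by [holomorphic_derive]. *)
Lemma recursion_holomorphic (n : nat) : holomorphic_on D (a n).
Proof.
induction n as [n IH] using (well_founded_induction lt_wf).
destruct n as [|n]; [exact (holomorphic_on_ext _ _ Ha0 Hphi)|].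
apply (holomorphic_on_ext (fun x => C_derive (a n) x + psi x * conv_minus2 a a (S n) x)).
- intros x Hx; rewrite Ha by (auto; lia); simpl; rewrite Nat.sub_0_r; reflexivity.
- intros x Hx; apply cdiff_plus; [apply (holomorphic_derive D); auto|].
  apply cdiff_mult; [exact (Hpsi x Hx)|].
  destruct n as [|n]; simpl; [apply cdiff_const|].
  apply conv_holomorphic; auto; intros; apply IH; lia.
Qed.

Lemma lseries_holomorphic : laurent_holomorphic D (lseries a).
Proof.
intros k x Hx; unfold coef; simpl.
destruct (k <=? 0)%Z; [apply recursion_holomorphic, Hx|apply cdiff_const].
Qed.

Lemma lseries_riccati :
  (tvar * ldx (lseries a))%L
    == (- (lfun psi * (lseries a * lseries a)) + tvar * tvar * lseries a
        - tvar * tvar * lfun phi)%L on D.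
Proof.
intros k x Hx.
rewrite coef_lsub, coef_ladd, coef_lopp, coef_tvar_mul, !coef_tvar2_mul, coef_lfun_mul.
unfold coef; simpl.
(* The left side lives in degrees [k <= 1], the quadratic term in [k <= 0] and the terms with
   [tvar * tvar] in [k <= 2]. *)
destruct (Z.leb_spec (k - 1) 0); destruct (Z.leb_spec (k - 2) 0);
  destruct (Z.leb_spec k 0); try lia.
(* For [k <= 0] the identity is the recursion at index [2 - k]. *)
- replace (Z.to_nat (- (k - 2))) with (S (S (Z.to_nat (- k)))) by lia.
  replace (Z.to_nat (- (k - 1))) with (S (Z.to_nat (- k))) by lia.
  rewrite (Ha (S (S (Z.to_nat (- k))))) by (auto; lia); simpl; ring.
(* Degree 1 is the recursion at index 1, whose sum is empty. *)
- replace k with 1%Z by lia; simpl.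
  change (Pos.to_nat 1) with 1%nat; simpl.
  rewrite (Ha 1%nat) by (auto; lia); simpl; ring.
(* In degree 2 the left side vanishes, and the initial value cancels the term with [phi]. *)
- replace k with 2%Z by lia; simpl; rewrite Ha0 by exact Hx; ring.
- ring.
Qed.

End Riccati.

Theorem proposition2p3
    (D : C -> Prop) (phi psi : C -> C) (a b : nat -> C -> C)
    (HD : domain D)
    (Hphi : holomorphic_on D phi) (Hpsi : holomorphic_on D psi)
    (Ha0 : forall x, D x -> a O x = phi x)
    (Hb0 : forall x, D x -> b O x = psi x)
    (Ha : forall (n : nat) (x : C), (1 <= n)%nat -> D x ->
       a n x = C_derive (a (n - 1)%nat) x + psi x * conv_minus2 a a n x)
    (Hb : forall (n : nat) (x : C), (1 <= n)%nat -> D x ->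
       b n x = C_derive (b (n - 1)%nat) x + phi x * conv_minus2 b b n x) :
  let F := lseries a in
  let G := lseries b in
  (laurent_holomorphic D F /\
   (tvar * ldx F)%L
     == (- (lfun psi * (F * F)) + tvar * tvar * F - tvar * tvar * lfun phi)%L on D)
  /\
  (laurent_holomorphic D G /\
   (tvar * ldx G)%L
     == (- (lfun phi * (G * G)) + tvar * tvar * G - tvar * tvar * lfun psi)%L on D).
Proof.
destruct HD as [HD' _]; intros F G; split; split.
- apply (lseries_holomorphic D phi psi); assumption.
- apply (lseries_riccati D phi psi); assumption.
(* The statement for [G] is that for [F] with [phi] and [psi] interchanged. *)
- apply (lseries_holomorphic D psi phi); assumption.
- apply (lseries_riccati D psi phi); assumption.
Qed.
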